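(* Let $H\in C(\mathbb R\times\mathbb R)$ be $\mathbb Z$-periodic in the first variable $x$, and convex and coercive in the second variable $p$. Let $V\in C_c(\mathbb R)$ and set $G(x,p):=H(x,p)-V(x)$. If $c(G)=c(H)=c_f(H)$, assume in addition that $H$ satisfies condition (U) stated in the context. For every $\lambda>0$, let $u^\lambda_G$ be the unique bounded viscosity solution of $$\lambda u(x)+G(x,u')=c(G)\qquad\text{in }\mathbb R.$$ Then the whole family $\{u^\lambda_G\}_{\lambda>0}$ converges, locally uniformly in $\mathbb R$ as $\lambda\to0^+$, to a function $u^0_G$ which is a viscosity solution of the critical equation $$G(x,u')=c(G)\qquad\text{in }\mathbb R.$$
   Context: Solutions and subsolutions are continuous and understood in the viscosity sense. Coercive in $p$ means $H(x,p)\to+\infty$ as $|p|\to+\infty$ (uniformly in $x$, by periodicity). For a Hamiltonian $F\in C(\mathbb R\times\mathbb R)$ define $$c(F):=\inf\{a\in\mathbb R:\ F(x,u')=a \text{ in }\mathbb R\text{ admits a bounded viscosity subsolution}\},$$ $$c_f(F):=\min\{a\in\mathbb R:\ F(x,u')=a \text{ in }\mathbb R\text{ admits a (possibly unbounded) viscosity subsolution}\}.$$ Let $u^\lambda_H$ be the unique bounded viscosity solution of $\lambda u+H(x,u')=c(H)$ in $\mathbb R$. It is known that $u^\lambda_H$ converges uniformly on $\mathbb R$ as $\lambda\to0^+$ to a $\mathbb Z$-periodic function, denoted $u^0_H$. Let $\mathcal E(H):=\{y\in\mathbb R:\ \min_{p\in\mathbb R}H(y,p)=c_f(H)\}$. Condition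 (U) (used only when $c(G)=c(H)=c_f(H)$): for all $x\in\mathbb R$, $$u^0_H(x)=\sup\{v(x):\ v\text{ is a }\mathbb Z\text{-periodic viscosity subsolution of }H(x,u')=c(H)\text{ in }\mathbb R\text{ with }v\le0\text{ on }\mathcal E(H)\}.$$ *)

(* Defs.v *)
From HB Require Import structures.
From mathcomp Require Import all_boot all_order all_algebra.
From mathcomp Require Import all_classical all_reals all_analysis.

Set Implicit Arguments.
Unset Strict Implicit.
Unset Printing Implicit Defensive.

Import Order.TTheory GRing.Theory Num.Theory.
Import numFieldNormedType.Exports.

Local Open Scope ring_scope.
Local Open Scope classical_set_scope.

Section viscosity.
Variable R : realType.
Implicit Types (E : R -> R -> R -> R) (u phi : R -> R).

Definition is_C1 phi : Prop :=
  (forall x : R, derivable phi x 1) /\ continuous (phi^`() : R -> R).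

(* A first-order equation E(x, u, u') = 0 on the whole line is encoded by
   E : R -> R -> R -> R, with arguments in the order (x, u, u'). *)
Definition visc_subsol E u : Prop :=
  continuous u /\
  forall phi (x : R), is_C1 phi ->
    (\forall y \near x, u y - phi y <= u x - phi x) ->
    E x (u x) (phi^`() x) <= 0.

Definition visc_supersol E u : Prop :=
  continuous u /\
  forall phi (x : R), is_C1 phi ->
    (\forall y \near x, u x - phi x <= u y - phi y) ->
    0 <= E x (u x) (phi^`() x).

Definition visc_sol E u : Prop := visc_subsol E u /\ visc_supersol E u.

End viscosity.

Section critical_values.
Variable R : realType.
Implicit Types F : R -> R -> R.

(* F(x, u') = a *)
Definition stationary F (a : R) : R -> R -> R -> R :=
  fun x _ p => F x p - a.

(* lam u + F(x, u') = a *)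
Definition discounted (lam : R) F (a : R) : R -> R -> R -> R :=
  fun x r p => lam * r + F x p - a.

(* [inf] is a genuine infimum here as soon as F(., 0) is bounded above and F is
   bounded below: then constants are subsolutions for large a, and no
   subsolution exists for a < inf F. *)
Definition crit F : R :=
  inf [set a : R | exists2 u : R -> R,
         visc_subsol (stationary F a) u & bounded_fun u].

(* The free critical value is a minimum: for the Hamiltonians considered here
   the infimum is attained, by stability of viscosity subsolutions, so that
   [inf] denotes that minimum. *)
Definition crit_free F : R :=
  inf [set a : R | exists u : R -> R, visc_subsol (stationary F a) u].

End critical_values.

Section hamiltonians.
Variable R : realType.
Implicit Types H : R -> R -> R.

Definition coercive H : Prop :=
  forall M : R, exists K : R, forall x p : R, K <= `|p| -> M <= H x p.

Definition compact_support (V : R -> R) : Prop :=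
  compact (closure [set x | V x != 0]).

(* y such that min_p H(y, p) = c_f(H). *)
Definition flat_set H : set R :=
  [set y | (exists p : R, H y p = crit_free H) /\
           forall p : R, crit_free H <= H y p].

(* For each lam > 0 the bounded solution is unique, so these families u agree
   on lam > 0. *)
Definition discounted_solutions H (u : R -> R -> R) : Prop :=
  forall lam : R, 0 < lam ->
    visc_sol (discounted lam H (crit H)) (u lam) /\ bounded_fun (u lam).

Definition discounted_limit H (u0 : R -> R) : Prop :=
  exists2 u : R -> R -> R, discounted_solutions H u &
    {uniform, u lam @[lam --> 0^'+] --> u0}.

(* u0 is characterized by [discounted_limit]: for H continuous, periodic in x,
   convex and coercive in p, the limit exists and is unique. *)
Definition condition_U H : Prop :=
  exists2 u0 : R -> R, discounted_limit H u0 &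
    forall x : R,
      u0 x = sup [set v x | v in [set v : R -> R |
        [/\ periodic v 1, visc_subsol (stationary H (crit H)) v &
            forall y, flat_set H y -> v y <= 0]]].

End hamiltonians.

(* Main.v *)
(* A subsolution in one space dimension is a locally Lipschitz function whose
   difference quotients stay in the convex hull of the sublevel sets of the
   Hamiltonian; this mean value form makes stability under minima, gluing and
   limits immediate.  Convergence then rests on a convexity trick: if [w] is a
   critical subsolution and [w <= u_m], then [(1 - t) w + t u_m] with
   [t = lam / m] is a subsolution of the [lam]-discounted equation, so that
   [w <= lim u_lam] for every limit point.  To get that two limit points [w] and
   [w'] satisfy [w <= w'], it remains to lower [w] near infinity below [u_m].
   If the periodic Hamiltonian has critical subsolutions drifting to [-oo] at
   that end, take a minimum with one of them.  If it only has subsolutions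
   drifting the other way, a barrier shows that the discounted solutions are
   almost periodic near that end, uniformly in the discount.  If all of them are
   periodic up to a constant, then [min_p H(x, p) = c] for every [x], the
   discounted solutions are nonpositive outside the support of [V], and [w] lies
   there below a critical subsolution that is nonpositive everywhere. *)
Require Import Defs.
From HB Require Import structures.
From mathcomp Require Import all_boot all_order all_algebra.
From mathcomp Require Import all_classical all_reals all_analysis.
From mathcomp Require Import ring lra.

Import Order.TTheory GRing.Theory Num.Theory.
Import numFieldNormedType.Exports.

Local Open Scope ring_scope.
Local Open Scope classical_set_scope.

(** * Convex coercive Hamiltonians *)

(** The obstacle is the two ends of the line. The discounted solutions [u_m] have a lower bound
    uniform in [m], but in general only a local upper bound, so a limit point may be unbounded and
    two limit points cannot be compared at infinity. What happens at an end is read off the drifts,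
    that is, the increments over one period, of critical subsolutions of the periodic Hamiltonian;
    they form an interval containing 0, and its position decides how a limit point is lowered. The
    left end is the right end of the reflected problem. Lowering is needed for a single [m] only:
    the convexity trick keeps [m] fixed while [lam] tends to 0. The local upper bound needs drifts
    too. If one sign is missing, a solution cannot descend from a great height at the corresponding
    end. If both signs occur, a solution positive on the middle part would produce a bounded
    subsolution below the critical level. Limit points are taken along ultrafilters finer than
    [0^'+]: pointwise bounds give a limit at every point at once, and the family converges as soon
    as all these limits agree. *)

Section Hamiltonians.
Set Implicit Arguments.
Unset Strict Implicit.
Context {R : realType}.
Implicit Types (F : R -> R -> R) (u v g : R -> R) (I : set R).

(** Continuity and periodicity in [x] enter only through bounds uniform in [x] for bounded [p]. In
    this form the class also contains the perturbed Hamiltonian, which is not periodic, and is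
    stable under reflection and translation. *)
Record good F : Prop := Good {
  good_convex : forall x p q t, 0 <= t <= 1 ->
    F x (t * p + (1 - t) * q) <= t * F x p + (1 - t) * F x q;
  good_coercive : coercive F;
  good_unif : forall K e, 0 < e -> exists2 d, 0 < d &
    forall x y p, `|p| <= K -> `|x - y| < d -> F x p <= F y p + e;
  good_bdd : forall K, exists M, forall x p, `|p| <= K -> `|F x p| <= M }.

Lemma good_between F x p q r a : good F -> p <= q <= r ->
  F x p <= a -> F x r <= a -> F x q <= a.
Proof.
move=> gF /andP[pq qr] Fp Fr.
have [pr|pr] := eqVneq p r.
  have -> : q = p by apply/eqP; rewrite eq_le pq andbT pr.
  by [].
have pr0 : 0 < r - p by rewrite subr_gt0 lt_neqAle pr (le_trans pq qr).
pose t := (r - q) / (r - p).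
have t0 : 0 <= t by apply: divr_ge0; [rewrite subr_ge0|exact: ltW].
have t1 : t <= 1 by rewrite /t ler_pdivrMr // mul1r lerD2l lerN2.
have -> : q = t * p + (1 - t) * r.
  have : t * (r - p) = r - q by rewrite /t mulfVK // gt_eqF.
  by move=> h; rewrite mulrBl mul1r; move: h; rewrite mulrBr => h; lra.
apply: (le_trans (good_convex gF _ _ _ _)); first by rewrite t0.
have : t * F x p <= t * a by apply: ler_wpM2l.
have : (1 - t) * F x r <= (1 - t) * a by apply: ler_wpM2l => //; lra.
lra.
Qed.

(** Convexity on the segment from [q] through [p] to the point [r] at distance one from [q]: the
    slope is at most the oscillation of [F] on the ball of radius [K + 1]. *)
Lemma good_lip F K : good F -> exists2 L, 0 <= L &
  forall x p q, `|q| <= K -> `|p - q| <= 1 -> F x p <= F x q + L * `|p - q|.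
Proof.
move=> gF; have [M MP] := good_bdd gF (K + 1).
exists (2 * `|M|) => [|x p q qK pq]; first by rewrite mulr_ge0.
have [->|npq] := eqVneq p q; first by rewrite subrr normr0 mulr0 addr0.
pose e := `|p - q|; have e0 : 0 < e by rewrite normr_gt0 subr_eq0.
pose r := q + (p - q) / e.
have hr : `|r| <= K + 1.
  apply: (le_trans (ler_normD _ _)); apply: lerD => //.
  by rewrite normrM normfV normr_id divff // gt_eqF.
have -> : F x p = F x (e * r + (1 - e) * q).
  congr F; rewrite /r mulrDr (mulrC e (_ / e)) mulfVK ?gt_eqF //; ring.
apply: (le_trans (good_convex gF _ _ _ _)); first by rewrite ltW.
have := MP x r hr; have := MP x q (le_trans qK _).
rewrite !ler_norml lerDl ler01 => /(_ isT) /andP[h1 h2] /andP[h3 h4].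
have hM := ler_norm M; rewrite mulrBl mul1r -/e.
have : e * (F x r - F x q) <= e * (2 * `|M|) by apply: ler_wpM2l; [exact: ltW|lra].
rewrite mulrBr; lra.
Qed.

Lemma good_bound F a : good F -> exists2 K, 0 < K &
  forall x p, F x p <= a -> `|p| <= K.
Proof.
(* Coercivity is a non-strict inequality, hence the level [a + 1]. *)
move=> gF; have [K KP] := good_coercive gF (a + 1).
exists (`|K| + 1) => [|x p Fp]; first by rewrite ltr_wpDl.
rewrite leNgt; apply/negP => pK.
have /(KP x) : K <= `|p| by have := ler_norm K; lra.
lra.
Qed.

Lemma good_lbound F : good F -> exists m, forall x p, m <= F x p.
Proof.
move=> gF; have [K KP] := good_coercive gF 0; have [M MP] := good_bdd gF `|K|.
exists (- `|M|) => x p; have [pK|Kp] := leP `|p| `|K|.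
  have := MP x p pK; rewrite ler_norml => /andP[+ _].
  by have := ler_norm M; lra.
by apply: le_trans (KP x p _); rewrite ?oppr_le0 // (le_trans (ler_norm K)) // ltW.
Qed.

Lemma good_cont F x q a : good F -> a < F x q ->
  exists2 r, 0 < r & forall p, `|p - q| < r -> a < F x p.
Proof.
move=> gF aq; have [L L0 LP] := good_lip (`|q| + 1) gF.
exists (Num.min 1 ((F x q - a) / (L + 1))).
  rewrite lt_min ltr01 /= divr_gt0 //; lra.
move=> p; rewrite lt_min => /andP[p1 pr].
have h : `|p| <= `|q| + 1.
  by rewrite -(subrK q p) addrC; apply: (le_trans (ler_normD _ _)); rewrite lerD2l ltW.
have := LP x q p h; rewrite distrC (ltW p1) => /(_ isT).
move: pr; rewrite ltr_pdivlMr; last lra.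
rewrite mulrDr mulr1 (mulrC L); have := normr_ge0 (p - q); lra.
Qed.

Lemma is_C1_intro (phi dphi : R -> R) :
  (forall x : R, is_derive x 1 phi (dphi x)) -> continuous dphi ->
  is_C1 phi /\ forall x, phi^`() x = dphi x.
Proof.
move=> d cd; have E : phi^`() = dphi.
  by apply/funext => x; rewrite derive1E; apply: derive_val.
by split; [split; [move=> x; apply: ex_derive|rewrite E]|move=> x; rewrite E].
Qed.

Lemma is_C1_is_derive (phi : R -> R) (x : R) : is_C1 phi -> is_derive x 1 phi (phi^`() x).
Proof. by move=> [d _]; apply: DeriveDef; [exact: d|rewrite derive1E]. Qed.

Lemma continuous_distP u : (forall x e, 0 < e -> exists2 d, 0 < d &
  forall y, `|x - y| < d -> `|u x - u y| < e) <-> continuous u.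
Proof.
split=> [h x|cu x e e0].
  apply/cvgrPdist_lt => e e0; have [d d0 dP] := h x e e0.
  by exists d.
have /cvgrPdist_lt/(_ e e0)[d /= d0 dP] := cu x.
by exists d.
Qed.

Lemma near_itv (y z x : R) : y < x < z -> \forall s \near x, y < s < z.
Proof.
move=> h; have := @near_in_itvoo R y z x; rewrite in_itv => /(_ h).
by apply: filterS => s; rewrite in_itv.
Qed.

Section Cont.
Context {T : topologicalType}.
Implicit Types f : T -> R.

Lemma contD f1 f2 : continuous f1 -> continuous f2 -> continuous (fun x => f1 x + f2 x).
Proof. by move=> c1 c2 x; apply: (@cvgD _ _ _ _ _ f1 f2); [exact: c1|exact: c2]. Qed.

Lemma contN f1 : continuous f1 -> continuous (fun x => - f1 x).
Proof. by move=> c1 x; apply: (@cvgN _ _ _ _ _ f1); exact: c1. Qed.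

Lemma contB f1 f2 : continuous f1 -> continuous f2 -> continuous (fun x => f1 x - f2 x).
Proof. by move=> c1 /contN; exact: contD. Qed.

Lemma contM f1 f2 : continuous f1 -> continuous f2 -> continuous (fun x => f1 x * f2 x).
Proof. by move=> c1 c2 x; apply: (@cvgM _ _ _ _ f1 f2); [exact: c1|exact: c2]. Qed.

Lemma cont_cst (a : R) : continuous (fun _ : T => a).
Proof. by move=> x; exact: cvg_cst. Qed.

Lemma cont_comp u f1 : continuous u -> continuous f1 -> continuous (fun x => u (f1 x)).
Proof. by move=> cu c1 x; apply: (@continuous_comp _ _ _ f1 u); [exact: c1|exact: cu]. Qed.

Lemma cont_min f1 f2 : continuous f1 -> continuous f2 ->
  continuous (fun x => Num.min (f1 x) (f2 x)).
Proof. by move=> c1 c2 x; apply: (@continuous_min _ _ f1 f2); [exact: c1|exact: c2]. Qed.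

Lemma cont_max f1 f2 : continuous f1 -> continuous f2 ->
  continuous (fun x => Num.max (f1 x) (f2 x)).
Proof. by move=> c1 c2 x; apply: (@continuous_max _ _ f1 f2); [exact: c1|exact: c2]. Qed.

End Cont.

Lemma cont_id : continuous (fun x : R => x).
Proof. by move=> x; exact: cvg_id. Qed.

(** These are the test functions of the doubling of variables, and of the stability of
    supersolutions, where they make a minimum strict. *)
Lemma is_C1_quad (a b y0 : R) :
  is_C1 (fun s => a * (s - y0) ^+ 2 + b * s ^+ 2) /\
  forall x, (fun s => a * (s - y0) ^+ 2 + b * s ^+ 2)^`() x = 2 * a * (x - y0) + 2 * b * x.
Proof.
apply: is_C1_intro => [x|].
  have -> : (fun s => a * (s - y0) ^+ 2 + b * s ^+ 2) =
      a *: ((id - cst y0) ^+ 2) + b *: (id ^+ 2) :> (R -> R).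
    by apply/funext => s.
  have d1 := is_deriveX 2 (is_deriveB (is_derive_id x (1 : R)) (is_derive_cst y0 x (1 : R))).
  have d2 := is_deriveX 2 (is_derive_id x (1 : R)).
  have d := is_deriveD (is_deriveZ a d1) (is_deriveZ b d2).
  apply: is_derive_eq d _.
  rewrite /GRing.scale /= !expr1 subr0 !mulr1.
  by transitivity (a * (2 * (x - y0)) + b * (2 * x)); [by []|ring].
apply: contD; apply: contM; (try exact: cont_cst); last exact: cont_id.
by apply: contB; [exact: cont_id|exact: cont_cst].
Qed.

Lemma is_C1_add (phi psi : R -> R) : is_C1 phi -> is_C1 psi ->
  is_C1 (fun s => phi s + psi s) /\
  forall x, (fun s => phi s + psi s)^`() x = derive1 phi x + derive1 psi x.
Proof.
move=> C1 C2; apply: is_C1_intro => [x|].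
  have d1 := is_C1_is_derive x C1; have d2 := is_C1_is_derive x C2.
  exact: is_deriveD.
by apply: contD; [exact: (proj2 C1)|exact: (proj2 C2)].
Qed.

End Hamiltonians.

(** * Subsolutions in mean value form *)

Section Subsolutions.
Set Implicit Arguments.
Unset Strict Implicit.
Context {R : realType}.
Implicit Types (F : R -> R -> R) (u v g : R -> R) (I : set R).

(** The Hamiltonian satisfied by [x |-> u (- x)]. Reflection exchanges upper and lower slope bounds,
    and the two ends of the line. *)
Definition mirr F : R -> R -> R := fun x p => F (- x) (- p).

(** The level is a number attached to the point, so that stationary and discounted equations share
    one test: the term [- m * u x] is absorbed in [a]. *)
Definition vtest F (a : R) u x : Prop := forall phi, is_C1 phi ->
  (\forall y \near x, u y - phi y <= u x - phi x) -> F x (phi^`() x) <= a.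

(* The slope of [u] on a segment of [I] lies in the convex hull of the sublevel
   sets [{p | F s p <= g s}]; for convex coercive [F] this is equivalent to the
   viscosity inequality [F x u' <= g x]. *)
Definition sub F g I u : Prop := continuous u /\
  forall y z, y < z -> (forall s, y <= s <= z -> I s) ->
    (forall b, (forall s p, y <= s <= z -> F s p <= g s -> p <= b) ->
       u z - u y <= b * (z - y)) /\
    (forall b, (forall s p, y <= s <= z -> F s p <= g s -> b <= p) ->
       b * (z - y) <= u z - u y).

Lemma is_C1_mirror (phi : R -> R) : is_C1 phi ->
  is_C1 (fun s => phi (- s)) /\ forall x, (fun s => phi (- s))^`() x = - derive1 phi (- x).
Proof.
move=> Cphi; apply: is_C1_intro => [x|].
  have d := is_C1_is_derive (- x) Cphi.
  have := @is_derive1_comp _ phi -%R x _ _ d (is_deriveNid x 1).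
  by rewrite mulrN1.
apply: contN; apply: cont_comp; [exact: (proj2 Cphi)|exact: (contN cont_id)].
Qed.

Lemma near_opp (P : R -> Prop) (x : R) :
  (\forall y \near x, P y) -> \forall y \near - x, P (- y).
Proof.
move=> /nbhs_ballP[e e0 h]; apply/nbhs_ballP; exists e => // y.
by rewrite /ball /= => hy; apply: h; rewrite /ball /= opprK -normrN opprD.
Qed.

Lemma vtest_mirror F a u x : vtest F a u x -> vtest (mirr F) a (fun s => u (- s)) (- x).
Proof.
move=> h phi Cphi tch; have [C' d'] := is_C1_mirror Cphi.
rewrite /mirr opprK; have := h _ C'; rewrite d'; apply.
by have := near_opp tch; rewrite !opprK; apply: filterS => y; rewrite opprK.
Qed.

Lemma continuous_mirror u : continuous u -> continuous (fun s => u (- s)).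
Proof.
by move=> cu; apply: cont_comp => //; exact: (contN cont_id).
Qed.

(** If the slope exceeded [b], subtracting a test function of slope slightly larger than [b] would
    leave an interior maximum, where the viscosity test puts a momentum larger than [b] in a
    sublevel set. *)
Lemma vtest_upper F g u y z b : continuous u -> y < z ->
  (forall x, y < x < z -> vtest F (g x) u x) ->
  (forall s p, y <= s <= z -> F s p <= g s -> p <= b) ->
  u z - u y <= b * (z - y).
Proof.
move=> cu yz tst hb; rewrite leNgt; apply/negP => bad.
pose k := (u z - u y - b * (z - y)) / (2 * (z - y)).
have k0 : 0 < k by rewrite divr_gt0 ?mulr_gt0 ?subr_gt0.
have kE : k * (z - y) = (u z - u y - b * (z - y)) / 2.
  by rewrite /k; field; rewrite subr_eq0 gt_eqF.
pose b' := b + k; pose psi s := u s - b' * s.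
have psiyz : psi y < psi z by rewrite /psi /b'; move: kE; rewrite mulrBr; lra.
have cpsi : continuous psi.
  by apply: contB => //; apply: contM; [exact: cont_cst|exact: cont_id].
have [z1 /andP[yz1 z1z] psiz1] : exists2 z1, y < z1 < z & psi y < psi z1.
  have /continuous_distP/(_ z (psi z - psi y)) := cpsi.
  rewrite subr_gt0 => /(_ psiyz)[d d0 dP].
  pose m := Num.min (d / 2) ((z - y) / 2).
  have m0 : 0 < m by rewrite lt_min !divr_gt0 ?subr_gt0.
  have [md mzy] : m <= d / 2 /\ m <= (z - y) / 2.
    by split; rewrite /m ge_min lexx ?orbT.
  exists (z - m); first by apply/andP; split; lra.
  have : `|psi z - psi (z - m)| < psi z - psi y.
    by apply: dP; rewrite opprB addrC subrK gtr0_norm //; lra.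
  by move=> /(le_lt_trans (ler_norm _)); lra.
pose eta := psi z - psi y; pose r := psi z1 - psi y.
have eta0 : 0 < eta by rewrite subr_gt0.
have r0 : 0 < r by rewrite subr_gt0.
have d0 : 0 < z - z1 by rewrite subr_gt0.
(* With this [N] the exponential term at [z1] is [eta * expR (- (eta / r))], which is less than [r]
   because [expR] exceeds the identity; so [z1] beats both endpoints. *)
pose N := eta / (r * (z - z1)).
have N0 : 0 < N by rewrite divr_gt0 // mulr_gt0.
(* The steep exponential keeps the maximum of [u - ph] away from [z]. *)
pose ph s := b' * s + eta * expR (N * (s - z)).
pose dph s := b' + eta * (N * expR (N * (s - z))).
have dpos s : b' < dph s by rewrite /dph ltrDl; apply: mulr_gt0 => //; apply: mulr_gt0 => //; exact: expR_gt0.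
have [Cph dphE] : is_C1 ph /\ forall x, ph^`() x = dph x.
  apply: is_C1_intro => [x|].
    have e1 : is_derive x 1 (fun s : R => N * (s - z)) N.
      have -> : (fun s : R => N * (s - z)) = (N *: (id - cst z)).
        by apply/funext => s; rewrite /= /GRing.scale /=.
      have : is_derive x 1 (N *: (id - cst z)) (N *: (1 - 0)) by apply: is_deriveZ.
      by rewrite subr0 /GRing.scale /= mulr1.
    have e2 := @is_derive1_comp _ expR (fun s : R => N * (s - z)) x _ _ (is_derive_expR _) e1.
    rewrite /= in e2.
    have -> : ph = (b' *: id) + (eta *: (expR \o (fun s : R => N * (s - z)))).
      by apply/funext => s.
    have : is_derive x 1 ((b' *: id) + (eta *: (expR \o (fun s : R => N * (s - z)))))
      (b' *: 1 + eta *: (expR (N * (x - z)) * N)).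
      by apply: is_deriveD; apply: is_deriveZ.
    by rewrite /GRing.scale /= mulr1 (mulrC _ N).
  apply: contD; first exact: cont_cst.
  apply: contM; first exact: cont_cst.
  apply: contM; first exact: cont_cst.
  apply: (@cont_comp _ _ expR (fun s => N * (s - z))); first exact: continuous_expR.
  by apply: contM; [exact: cont_cst|apply: contB; [exact: cont_id|exact: cont_cst]].
have cph : continuous ph.
  move=> s; apply/differentiable_continuous/derivable1_diffP.
  exact: (proj1 Cph).
have cuph : {within `[y, z], continuous (fun s => u s - ph s)}.
  by apply: continuous_subspaceT; exact: contB.
have [x] := EVT_max (ltW yz) cuph.
rewrite in_itv /= => /andP[yx xz] xmax.
have phz : ph z = b' * z + eta by rewrite /ph subrr mulr0 expR0 mulr1.
have phy : b' * y < ph y by rewrite /ph ltrDl; apply: mulr_gt0 => //; exact: expR_gt0.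
have phz1 : ph z1 < b' * z1 + r.
  rewrite /ph ltrD2l.
  have -> : N * (z1 - z) = - (eta / r).
    by rewrite /N; field; rewrite !gt_eqF.
  rewrite expRN -ltr_pdivlMr ?invr_gt0 ?expR_gt0 // invrK.
  rewrite -ltr_pdivrMl // mulrC.
  apply: lt_le_trans (expR_ge1Dx _); by rewrite ltrDr.
have z1x : u z1 - ph z1 <= u x - ph x.
  by apply: xmax; rewrite in_itv /= !ltW.
have xy : x != y.
  by apply/eqP => E; move: z1x; rewrite E; rewrite /r /psi in phz1; lra.
have xz' : x != z.
  by apply/eqP => E; move: z1x; rewrite E phz; rewrite /eta /r /psi in phz1 *; lra.
have hx : y < x < z by rewrite !lt_neqAle eq_sym xy xz' yx xz.
have := tst x hx ph Cph.
have nr : \forall y0 \near x, u y0 - ph y0 <= u x - ph x.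
  apply: filterS (near_itv hx) => s /andP[h1 h2].
  by apply: xmax; rewrite in_itv /= !ltW.
move=> /(_ nr); rewrite dphE => Fx.
have : dph x <= b by apply: (hb x) => //; rewrite yx xz.
by have := dpos x; rewrite /b'; lra.
Qed.

(** The lower slope bound is the upper one for the reflected function. *)
Lemma vtest_sub F g I u : continuous u ->
  (forall x, (\forall s \near x, I s) -> vtest F (g x) u x) -> sub F g I u.
Proof.
move=> cu tst; split=> // y z yz yzI.
have int x : y < x < z -> vtest F (g x) u x.
  move=> xyz; apply: tst.
  by apply: filterS (near_itv xyz) => s /andP[h1 h2]; apply: yzI; rewrite !ltW.
split=> b hb; first exact: vtest_upper hb.
have := @vtest_upper (mirr F) (fun s => g (- s)) (fun s => u (- s)) (- z) (- y) (- b).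
rewrite !opprK ltrN2 => H.
have : u y - u z <= - b * (- y + z).
  apply: H => //.
  - exact: continuous_mirror.
  - move=> x /andP[h1 h2]; rewrite -[x]opprK; rewrite opprK.
    rewrite -{2}[x]opprK; apply: vtest_mirror; apply: int.
    by apply/andP; split; lra.
  - move=> s p /andP[h1 h2]; rewrite /mirr => hF.
    rewrite lerNr; apply: (hb (- s)) => //; by apply/andP; split; lra.
lra.
Qed.

End Subsolutions.

(** * Back to the viscosity test, and stability of subsolutions *)

Section SubsolutionOperations.
Set Implicit Arguments.
Unset Strict Implicit.
Context {R : realType}.
Implicit Types (F : R -> R -> R) (u v g : R -> R) (I : set R).

(** The set [{p | F x p <= a}] is an interval. If it misses the slope [q], it misses a neighbourhood
    of radius [r0], so it lies wholly below [q - r0] or wholly above [q + r0], and the mean value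
    bounds are violated. *)
Lemma sub_quot F g I u x r a : good F -> sub F g I u ->
  (forall s, `|s - x| < r -> I s) ->
  (forall s p, `|s - x| < r -> F s p <= g s -> F x p <= a) ->
  forall y z, `|y - x| < r -> `|z - x| < r -> y < z ->
  F x ((u z - u y) / (z - y)) <= a.
Proof.
move=> gF [_ su] rI rF y z yr zr yz; set q := _ / _.
rewrite leNgt; apply/negP => aq.
have [r0 r00 r0P] := good_cont gF aq.
have seg s : y <= s <= z -> `|s - x| < r.
  by move: yr zr; rewrite !ltr_distl => /andP[? ?] /andP[? ?] /andP[? ?]; apply/andP; split; lra.
have [up lo] := su y z yz (fun s h => rI s (seg s h)).
have zy0 : 0 < z - y by rewrite subr_gt0.
have qE : u z - u y = q * (z - y) by rewrite /q mulfVK // gt_eqF.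
have pos : 0 < r0 * (z - y) by apply: mulr_gt0.
have [below|/existsNP[p1 /not_implyP[Fp1 /negP]]] := pselect (forall p, F x p <= a -> p <= q).
  have : u z - u y <= (q - r0) * (z - y).
    apply: up => s p ys Fs; have Fx := rF _ _ (seg _ ys) Fs.
    have pq := below p Fx; rewrite leNgt; apply/negP => h.
    have : a < F x p by apply: r0P; rewrite ltr_distl; clear - h pq r00; apply/andP; split; lra.
    by rewrite ltNge Fx.
  by rewrite qE mulrBl; clear - pos; lra.
rewrite -ltNge => qp1.
have : (q + r0) * (z - y) <= u z - u y.
  apply: lo => s p ys Fs; have Fx := rF _ _ (seg _ ys) Fs.
  rewrite leNgt; apply/negP => h.
  have [pq|qp] := leP p q.
    have : F x q <= a by apply: (good_between gF _ Fx Fp1); rewrite pq ltW.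
    by rewrite leNgt aq.
  have : a < F x p by apply: r0P; rewrite ltr_distl; clear - h qp r00; apply/andP; split; lra.
  by rewrite ltNge Fx.
by rewrite qE mulrDl; clear - pos; lra.
Qed.

Lemma is_derive_dist (phi : R -> R) (x d e : R) : is_derive x 1 phi d -> 0 < e ->
  exists2 del, 0 < del & forall h, 0 < `|h| -> `|h| < del ->
    `|(phi (x + h) - phi x) / h - d| < e.
Proof.
move=> [der <-] e0; move: der; rewrite /derivable => /cvg_ex[l hl].
have := cvg_lim (@Rhausdorff R) hl; rewrite /derive => ->.
move/cvgrPdist_lt: hl => /(_ e e0); rewrite near_withinE => /nbhs_ballP[del /= del0 hdel].
exists del => // h h0 hd.
have := hdel h; rewrite /ball /= sub0r normrN => /(_ hd).
rewrite -normr_gt0 => /(_ h0).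
by rewrite distrC /GRing.scale /= mulr1 mulrC (addrC h).
Qed.

(** At a touching point the right quotient of [u] is at most about [phi'] and the left one at least
    about [phi']. Both lie in the sublevel interval, which a neighbourhood of [phi'] would avoid if
    [phi'] did; hence [phi'] is between them and in the interval. *)
Lemma quot_vtest F u x d0 a : good F -> 0 < d0 ->
  (forall y z, `|y - x| < d0 -> `|z - x| < d0 -> y < z -> F x ((u z - u y) / (z - y)) <= a) ->
  vtest F a u x.
Proof.
move=> gF d00 hq phi Cphi /nbhs_ballP[r /= r0 hr].
rewrite leNgt; apply/negP => aF.
set d := phi^`() x in aF.
have [e e0 eP] := good_cont gF aF.
have [del del0 delP] := is_derive_dist (is_C1_is_derive x Cphi) e0.
pose h := Num.min (Num.min d0 r) del / 2.
have m0 : 0 < Num.min (Num.min d0 r) del by rewrite !lt_min d00 r0 del0.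
have h0 : 0 < h by rewrite divr_gt0.
have [hd0 hr' hdel] : [/\ h < d0, h < r & h < del].
  have hm : h < Num.min (Num.min d0 r) del by rewrite /h ltr_pdivrMr // ltr_pMr // ltr1n.
  by move: hm; rewrite !lt_min => /andP[/andP[]].
have hn : `|h| = h by rewrite gtr0_norm.
have tr : u (x + h) - phi (x + h) <= u x - phi x.
  by apply: hr; rewrite /ball /= opprD addrA subrr sub0r normrN hn.
have tl : u (x - h) - phi (x - h) <= u x - phi x.
  by apply: hr; rewrite /ball /= opprB addrC subrK hn.
pose qr := (u (x + h) - u x) / (x + h - x).
pose ql := (u x - u (x - h)) / (x - (x - h)).
have Er : qr * h = u (x + h) - u x.
  by rewrite /qr (addrC x) addrK mulfVK // gt_eqF.
have El : ql * h = u x - u (x - h).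
  by rewrite /ql opprB (addrCA x) subrr addr0 mulfVK // gt_eqF.
have Fqr : F x qr <= a.
  by apply: hq; rewrite ?subrr ?normr0 // ?ltrDl // (addrC x) addrK hn.
have Fql : F x ql <= a.
  apply: hq; rewrite ?subrr ?normr0 // ?gtrDl ?oppr_lt0 //.
  by rewrite addrC addrA (addrC (- x)) subrr sub0r normrN hn.
have dr := delP h; rewrite hn in dr; have {}dr := dr h0 hdel.
have dl := delP (- h); rewrite normrN hn in dl; have {}dl := dl h0 hdel.
move: dr dl; rewrite !ltr_distl -/d => /andP[_ dr] /andP[dl _].
have dr' : phi (x + h) - phi x < (d + e) * h by rewrite -ltr_pdivrMr.
have dl' : (d - e) * h < phi x - phi (x - h).
  by rewrite -ltr_pdivlMr // -[X in X / h]opprB mulNr -mulrN -invrN.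
have qrd : qr < d + e by rewrite -(ltr_pM2r h0) Er; clear - dr' tr; lra.
have qld : d - e < ql by rewrite -(ltr_pM2r h0) El; clear - dl' tl; lra.
have qr_le : qr <= d.
  rewrite leNgt; apply/negP => hh.
  have : a < F x qr by apply: eP; rewrite ltr_distl; clear - hh qrd e0; apply/andP; split; lra.
  by rewrite ltNge Fqr.
have ql_ge : d <= ql.
  rewrite leNgt; apply/negP => hh.
  have : a < F x ql by apply: eP; rewrite ltr_distl; clear - hh qld e0; apply/andP; split; lra.
  by rewrite ltNge Fql.
have : F x d <= a by apply: (good_between gF _ Fqr Fql); rewrite qr_le.
by rewrite leNgt aF.
Qed.

(** Difference quotients replace derivatives from here on: near [x] they satisfy the inequality
    frozen at [x] up to [e], without any differentiability of [u]. [sub_of_quot] is the converse. *)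
Lemma sub_quot_near F g I u x e : good F -> sub F g I u -> continuous g ->
  (\forall s \near x, I s) -> 0 < e -> exists2 r, 0 < r &
  forall y z, `|y - x| < r -> `|z - x| < r -> y < z ->
  F x ((u z - u y) / (z - y)) <= g x + e.
Proof.
move=> gF su /continuous_distP cg /nbhs_ballP[r1 /= r10 r1P] e0.
pose e' := Num.min 1 (e / 2).
have e'0 : 0 < e' by rewrite lt_min ltr01 divr_gt0.
have [K _ KP] := good_bound (g x + 1) gF.
have [r2 r20 r2P] := good_unif gF K e'0.
have [r3 r30 r3P] := cg x e' e'0.
have [e'1 e'e] : e' <= 1 /\ e' <= e / 2 by rewrite /e' !ge_min !lexx orbT.
exists (Num.min (Num.min r1 r2) r3); first by rewrite !lt_min r10 r20 r30.
apply: (sub_quot gF su) => [s|s p]; rewrite !lt_min => /andP[/andP[h1 h2] h3].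
  by apply: r1P; rewrite /ball /= distrC.
move=> Fs; have := r3P s; rewrite distrC => /(_ h3).
rewrite ltr_distl => /andP[h4 h5].
have pK : `|p| <= K by apply: (KP s); lra.
by have := r2P x s p pK; rewrite distrC => /(_ h2); lra.
Qed.

Lemma vtest_le F a u x : (forall e, 0 < e -> vtest F (a + e) u x) -> vtest F a u x.
Proof.
move=> h phi C t; apply/ler_addgt0Pr => e e0; exact: h.
Qed.

Lemma sub_vtest F g I u x : good F -> sub F g I u -> continuous g ->
  (\forall s \near x, I s) -> vtest F (g x) u x.
Proof.
move=> gF su cg nI; apply: vtest_le => e e0.
have [r r0 rP] := sub_quot_near gF su cg nI e0.
exact: quot_vtest rP.
Qed.

Lemma sub_of_quot F g I u : good F -> continuous u ->
  (forall x e, (\forall s \near x, I s) -> 0 < e -> exists2 r, 0 < r &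
    forall y z, `|y - x| < r -> `|z - x| < r -> y < z ->
    F x ((u z - u y) / (z - y)) <= g x + e) -> sub F g I u.
Proof.
move=> gF cu hq; apply: vtest_sub => // x nI; apply: vtest_le => e e0.
have [r r0 rP] := hq x e nI e0; exact: quot_vtest rP.
Qed.

Lemma sub_le F g g' I I' u : sub F g I u -> I' `<=` I ->
  (forall s, I' s -> g s <= g' s) -> sub F g' I' u.
Proof.
move=> [cu su] II gg; split=> // y z yz yzI.
have [up lo] := su y z yz (fun s h => II _ (yzI s h)).
by split=> b hb; [apply: up|apply: lo] => s p ys Fs; apply: (hb s) => //;
  apply: le_trans Fs _; apply: gg; exact: yzI.
Qed.

Lemma sub_le_eq F F' g I u : sub F g I u ->
  (forall s p, I s -> F' s p <= F s p) -> sub F' g I u.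
Proof.
move=> [cu su] FF; split=> // y z yz yzI; have [up lo] := su y z yz yzI.
by split=> b hb; [apply: up|apply: lo] => s p ys Fs; apply: (hb s) => //;
  apply: le_trans Fs; apply: FF; exact: yzI.
Qed.

Lemma sub_addc F g I u a : sub F g I u -> sub F g I (fun x => u x + a).
Proof.
move=> [cu su]; split=> [|y z yz yzI]; first by apply: contD => //; exact: cont_cst.
have [up lo] := su y z yz yzI.
by split=> b hb; rewrite opprD addrACA subrr addr0; [apply: up|apply: lo].
Qed.

(** Difference quotients are linear in the function and [F x] is convex. *)
Lemma sub_conv F g1 g2 I u1 u2 t : good F -> continuous g1 -> continuous g2 ->
  sub F g1 I u1 -> sub F g2 I u2 -> 0 <= t <= 1 ->
  sub F (fun x => t * g1 x + (1 - t) * g2 x) I (fun x => t * u1 x + (1 - t) * u2 x).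
Proof.
move=> gF c1 c2 s1 s2 /andP[t0 t1]; apply: sub_of_quot => //.
  by apply: contD; apply: contM; (exact: cont_cst || exact: (proj1 s1) || exact: (proj1 s2)).
move=> x e nI e0.
have [r1 r10 h1] := sub_quot_near gF s1 c1 nI e0.
have [r2 r20 h2] := sub_quot_near gF s2 c2 nI e0.
exists (Num.min r1 r2); first by rewrite lt_min r10.
move=> y z; rewrite !lt_min => /andP[y1 y2] /andP[z1 z2] yz.
have {}h1 := h1 y z y1 z1 yz; have {}h2 := h2 y z y2 z2 yz.
have -> : (t * u1 z + (1 - t) * u2 z - (t * u1 y + (1 - t) * u2 y)) / (z - y) =
  t * ((u1 z - u1 y) / (z - y)) + (1 - t) * ((u2 z - u2 y) / (z - y)).
  by field; rewrite subr_eq0 gt_eqF.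
apply: (le_trans (good_convex gF _ _ _ _)); first by rewrite t0.
have e1 : t * F x ((u1 z - u1 y) / (z - y)) <= t * (g1 x + e) by apply: ler_wpM2l.
have e2 : (1 - t) * F x ((u2 z - u2 y) / (z - y)) <= (1 - t) * (g2 x + e).
  by apply: ler_wpM2l => //; lra.
lra.
Qed.

(** A bound on increments passes to the minimum whichever branches are active at [y] and [z]. For
    viscosity subsolutions, stability under minima is a feature of convex Hamiltonians. *)
Lemma sub_min F g I u1 u2 : sub F g I u1 -> sub F g I u2 ->
  sub F g I (fun x => Num.min (u1 x) (u2 x)).
Proof.
move=> [c1 s1] [c2 s2]; split=> [|y z yz yzI]; first exact: cont_min.
have [up1 lo1] := s1 y z yz yzI; have [up2 lo2] := s2 y z yz yzI.
split=> b hb.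
  by have := up1 b hb; have := up2 b hb; rewrite !minElt; case: (ltP (u1 z)); case: (ltP (u1 y)); lra.
by have := lo1 b hb; have := lo2 b hb; rewrite !minElt; case: (ltP (u1 z)); case: (ltP (u1 y)); lra.
Qed.

Lemma sub_max F g I u1 u2 : sub F g I u1 -> sub F g I u2 ->
  sub F g I (fun x => Num.max (u1 x) (u2 x)).
Proof.
move=> [c1 s1] [c2 s2]; split=> [|y z yz yzI]; first exact: cont_max.
have [up1 lo1] := s1 y z yz yzI; have [up2 lo2] := s2 y z yz yzI.
split=> b hb.
  by have := up1 b hb; have := up2 b hb; rewrite !maxElt; case: (ltP (u1 z)); case: (ltP (u1 y)); lra.
by have := lo1 b hb; have := lo2 b hb; rewrite !maxElt; case: (ltP (u1 z)); case: (ltP (u1 y)); lra.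
Qed.

Definition splice (X : R) u1 u2 : R -> R := fun x => if x <= X then u1 x else u2 x.

Lemma splice_cont X u1 u2 : continuous u1 -> continuous u2 -> u1 X = u2 X ->
  continuous (splice X u1 u2).
Proof.
move=> c1 c2 E.
have -> : splice X u1 u2 = fun x => u1 (Num.min x X) + u2 (Num.max x X) - u1 X.
  by apply/funext => x; rewrite /splice minElt maxElt E; case: ltgtP => [||->]; rewrite ?E; lra.
apply: contB; last exact: cont_cst.
apply: contD; apply: cont_comp => //.
  by apply: cont_min; [exact: cont_id|exact: cont_cst].
by apply: cont_max; [exact: cont_id|exact: cont_cst].
Qed.

Lemma sub_eq F g I u v : sub F g I u -> continuous v -> (forall s, I s -> u s = v s) ->
  sub F g I v.
Proof.
move=> [cu su] cv uv; split=> // y z yz yzI; have [up lo] := su y z yz yzI.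
rewrite -!uv; first by split.
- by apply: yzI; rewrite lexx ltW.
- by apply: yzI; rewrite lexx ltW.
Qed.

(** Increments add up across [X], so gluing imposes no condition on the one-sided derivatives
    there. *)
Lemma sub_join F g I u X : sub F g (I `&` [set x | x <= X]) u ->
  sub F g (I `&` [set x | X <= x]) u -> sub F g I u.
Proof.
move=> [cu s1] [_ s2]; split=> // y z yz yzI.
have [zX|Xz] := leP z X.
  by apply: s1 => // s /[dup] /yzI Is /andP[h1 h2]; split => //=; lra.
have [Xy|yX] := leP X y.
  by apply: s2 => // s /[dup] /yzI Is /andP[h1 h2]; split => //=; lra.
have [|up1 lo1] := s1 y X yX.
  by move=> s /andP[h1 h2]; split => //=; apply: yzI; rewrite h1 /=; lra.
have [|up2 lo2] := s2 X z Xz.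
  by move=> s /andP[h1 h2]; split => //=; apply: yzI; rewrite h2 andbT; lra.
split=> b hb.
  have h1 : u X - u y <= b * (X - y).
    by apply: up1 => s p /andP[h1 h2]; apply: hb; rewrite h1 /=; lra.
  have h2 : u z - u X <= b * (z - X).
    by apply: up2 => s p /andP[h3 h2]; apply: hb; rewrite h2 andbT; lra.
  lra.
have h1 : b * (X - y) <= u X - u y.
  by apply: lo1 => s p /andP[h1 h2]; apply: hb; rewrite h1 /=; lra.
have h2 : b * (z - X) <= u z - u X.
  by apply: lo2 => s p /andP[h3 h2]; apply: hb; rewrite h2 andbT; lra.
lra.
Qed.

Lemma sub_splice F g I u1 u2 X : u1 X = u2 X ->
  sub F g (I `&` [set x | x <= X]) u1 -> sub F g (I `&` [set x | X <= x]) u2 ->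
  sub F g I (splice X u1 u2).
Proof.
move=> E s1 s2; have cg := splice_cont (proj1 s1) (proj1 s2) E.
apply: (@sub_join _ _ _ _ X).
  by apply: sub_eq s1 cg _ => s [_ /= h]; rewrite /splice h.
apply: sub_eq s2 cg _ => s [_ /= h]; rewrite /splice; case: leP => // h'.
by have -> : s = X by apply/eqP; rewrite eq_le h h'.
Qed.

Lemma sub_local F g u : good F -> continuous u -> continuous g ->
  (forall x : R, exists2 I : set R, (\forall s \near x, I s) & sub F g I u) -> sub F g setT u.
Proof.
move=> gF cu cg h; apply: vtest_sub => // x _.
by have [I nI sI] := h x; exact: sub_vtest sI cg nI.
Qed.

Lemma sub_add_line F g g' I u e : sub F g I u ->
  (forall s p, I s -> F s p <= g s -> F s (p + e) <= g' s) ->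
  sub F g' I (fun x => u x + e * x).
Proof.
move=> [cu su] h; split=> [|y z yz yzI].
  by apply: contD => //; apply: contM; [exact: cont_cst|exact: cont_id].
have [up lo] := su y z yz yzI.
split=> b hb.
  have : u z - u y <= (b - e) * (z - y).
    by apply: up => s p ys Fs; rewrite lerBrDr; apply: (hb s) => //; apply: h => //; exact: yzI.
  lra.
have : (b - e) * (z - y) <= u z - u y.
  by apply: lo => s p ys Fs; rewrite lerBlDr; apply: (hb s) => //; apply: h => //; exact: yzI.
lra.
Qed.

Lemma sub_shift F g I u a : sub F g I u ->
  sub (fun x p => F (x + a) p) (fun x => g (x + a)) [set x | I (x + a)] (fun x => u (x + a)).
Proof.
move=> [cu su]; split=> [|y z yz yzI].
  by apply: cont_comp => //; apply: contD; [exact: cont_id|exact: cont_cst].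
have yza : y + a < z + a by rewrite ltrD2r.
have [|up lo] := su _ _ yza.
  by move=> s hs; have := yzI (s - a); rewrite /= subrK; apply; rewrite lerBrDr lerBlDr.
have -> : z - y = z + a - (y + a) by lra.
by split=> b hb; [apply: up|apply: lo] => s p hs Fs; apply: (hb (s - a));
  rewrite ?subrK ?lerBrDr ?lerBlDr.
Qed.

Lemma sub_mirror F g I u : sub F g I u ->
  sub (mirr F) (fun x => g (- x)) [set x | I (- x)] (fun x => u (- x)).
Proof.
move=> [cu su]; split=> [|y z yz yzI]; first exact: continuous_mirror.
have yza : - z < - y by rewrite ltrN2.
have [|up lo] := su _ _ yza.
  by move=> s hs; have := yzI (- s); rewrite /= opprK; apply; rewrite lerNr lerNl andbC.
split=> b hb.
  have : - b * (- y - - z) <= u (- y) - u (- z).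
    apply: lo => s p hs Fs; rewrite lerNl; apply: (hb (- s)); last by rewrite /mirr !opprK.
    by rewrite lerNr lerNl andbC.
  lra.
have : u (- y) - u (- z) <= - b * (- y - - z).
  apply: up => s p hs Fs; rewrite lerNr; apply: (hb (- s)); last by rewrite /mirr !opprK.
  by rewrite lerNr lerNl andbC.
lra.
Qed.

Lemma sub_lip F g I u K : sub F g I u ->
  (forall s p, I s -> F s p <= g s -> `|p| <= K) ->
  forall y z, y <= z -> (forall s, y <= s <= z -> I s) -> `|u z - u y| <= K * (z - y).
Proof.
move=> [_ su] hK y z; rewrite le_eqVlt => /orP[/eqP->|yz] yzI.
  by rewrite !subrr normr0 mulr0.
have [up lo] := su y z yz yzI; rewrite ler_norml; apply/andP; split.
  rewrite -mulNr; apply: lo => s p ys Fs.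
  by have := hK s p (yzI s ys) Fs; rewrite ler_norml => /andP[].
apply: up => s p ys Fs.
by have := hK s p (yzI s ys) Fs; rewrite ler_norml => /andP[].
Qed.

Lemma lim_le (T : Type) (U : set_system T) {UF : ProperFilter U} (f : T -> R) l a :
  f t @[t --> U] --> l -> (\forall t \near U, f t <= a) -> l <= a.
Proof. by move=> fl fa; apply: (closed_cvg [set x : R | x <= a] (@closed_le _ a) fa). Qed.

Lemma lim_ge (T : Type) (U : set_system T) {UF : ProperFilter U} (f : T -> R) l a :
  f t @[t --> U] --> l -> (\forall t \near U, a <= f t) -> a <= l.
Proof. by move=> fl fa; apply: (closed_cvg [set x : R | a <= x] (@closed_ge _ a) fa). Qed.

Lemma sub_limit (T : Type) (U : set_system T) {UF : ProperFilter U} F g I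
    (f : T -> R -> R) w : continuous w -> (\forall t \near U, sub F g I (f t)) ->
  (forall x, f t x @[t --> U] --> w x) -> sub F g I w.
Proof.
move=> cw sf fw; split=> // y z yz yzI.
have lim : (f t z - f t y) @[t --> U] --> w z - w y.
  by apply: (@cvgB _ _ _ U _ (fun t => f t z) (fun t => f t y)).
split=> b hb.
  by apply: (lim_le lim); apply: filterS sf => t [_ st]; apply: (proj1 (st y z yz yzI)).
by apply: (lim_ge lim); apply: filterS sf => t [_ st]; apply: (proj2 (st y z yz yzI)).
Qed.

Lemma sub_le_eps F g u : good F -> continuous g ->
  (forall e, 0 < e -> sub F (fun x => g x + e) setT u) -> sub F g setT u.
Proof.
move=> gF cg h; apply: vtest_sub; first exact: proj1 (h 1 ltr01).
move=> x _; apply: vtest_le => e e0.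
apply: (sub_vtest gF (h e e0)); last exact: filterT.
by apply: contD => //; exact: cont_cst.
Qed.

End SubsolutionOperations.

(** * Comparison principle *)

Section Comparison.
Set Implicit Arguments.
Unset Strict Implicit.
Context {R : realType}.
Implicit Types (F : R -> R -> R) (u v g : R -> R) (I : set R).

Lemma cont_fst : continuous (fst : R * R -> R).
Proof. by move=> z; exact: cvg_fst. Qed.

Lemma cont_snd : continuous (snd : R * R -> R).
Proof. by move=> z; exact: cvg_snd. Qed.

(** Doubling of variables with fixed parameters instead of limits. Coercivity bounds the penalty
    momentum [p] by [K], and this alone makes the two points close once [n] is large compared with
    [K / d]. *)
Lemma discounted_comparison F lam c u v C : good F -> 0 < lam ->
  visc_supersol (discounted lam F c) u -> (forall x, - C <= u x) ->
  sub F (fun x => c - lam * v x) setT v -> (forall x, `|v x| <= C) ->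
  forall x, v x <= u x.
Proof.
move=> gF lam0 [cu su] uC sv vC x0; have cv := proj1 sv.
have C0 : 0 <= C := le_trans (normr_ge0 _) (vC 0).
apply/ler_addgt0Pr => k k0.
have vtst x : vtest F (c - lam * v x) v x.
  apply: (sub_vtest gF sv); last exact: filterT.
  apply: contB; first exact: cont_cst.
  by apply: contM => //; exact: cont_cst.
have [K K0 KP] := good_bound (c + lam * C) gF.
have [L L0 LP] := good_lip K gF.
(* Two errors of size [e] occur, from moving [x] and from shifting the momentum; together they cost
   [k / 2] after division by [lam]. *)
pose e := lam * k / 4; have e0 : 0 < e by rewrite divr_gt0 // mulr_gt0.
have [d d0 dP] := good_unif gF K e0.
pose D := `|u 0| + `|v 0| + 2 * C + 1.
have D0 : 0 < D by rewrite ltr_wpDl // !addr_ge0 // mulr_ge0.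
pose eta := Num.min 1 (e / (L + 1)).
have L1 : 0 < L + 1 by lra.
have eta0 : 0 < eta by rewrite lt_min ltr01 divr_gt0.
have eta1 : eta <= 1 by rewrite ge_min lexx.
have etaL : L * eta <= e.
  have h : eta <= e / (L + 1) by rewrite ge_min lexx orbT.
  have : eta * (L + 1) <= e by rewrite -ler_pdivlMr.
  lra.
(* Since [del * b ^+ 2 <= D], the first bound keeps the localisation momentum [2 * del * b] below
   [eta]; the second keeps the cost of localisation at [x0] below [k / 4]. *)
pose del := Num.min (eta ^+ 2 / (4 * D)) (k / (4 * (x0 ^+ 2 + 1))).
have del0 : 0 < del.
  rewrite lt_min !divr_gt0 ?exprn_gt0 ?mulr_gt0 //.
  by rewrite ltr_wpDl // sqr_ge0.
have del1 : del * (4 * D) <= eta ^+ 2.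
  by rewrite -ler_pdivlMr ?mulr_gt0 // ge_min lexx.
have del2 : del * x0 ^+ 2 <= k / 4.
  have h : 0 < x0 ^+ 2 + 1 by rewrite ltr_wpDl // sqr_ge0.
  have : del * (4 * (x0 ^+ 2 + 1)) <= k by rewrite -ler_pdivlMr ?mulr_gt0 // ge_min lexx orbT.
  lra.
(* The summand [del] gives [del <= n], so that [b] and [a - b] are both bounded by the same [s]. *)
pose n := K / d + del.
have n0 : 0 < n by rewrite addr_gt0 // divr_gt0.
have nK : K < 2 * n * d.
  have : K / d * d = K by rewrite mulfVK // gt_eqF.
  have : 0 < del * d by apply: mulr_gt0.
  by rewrite /n; lra.
have ndel : del <= n by rewrite /n lerDr divr_ge0 // ltW.
pose s := D / del + 1.
have s1 : 1 <= s by rewrite lerDr divr_ge0 // ltW.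
have sD : D < del * s ^+ 2.
  have : D / del * del = D by rewrite mulfVK // gt_eqF.
  have : s <= s ^+ 2 by rewrite expr2 ler_peMl // (le_trans ler01).
  move=> h1 h2; have : del * s <= del * s ^+ 2 by rewrite ler_pM2l.
  by rewrite {1}/s; clear - h2 del0; lra.
(* Larger than [2 * s], so that the minimiser on the square is interior, and large enough for
   [(x0, x0)] to compete. *)
pose B := 2 * s + 1 + `|x0|.
have nx0 := normr_ge0 x0.
have B0 : 0 <= B by rewrite /B; clear - s1 nx0; lra.
have x0B : `|x0| <= B by rewrite /B; clear - s1; lra.
pose Phi (z : R * R) := u z.2 - v z.1 + (n * ((z.1 - z.2) * (z.1 - z.2)) + del * (z.2 * z.2)).
have cPhi : continuous Phi.
  apply: contD.
    by apply: contB; apply: cont_comp => //; [exact: cont_snd|exact: cont_fst].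
  apply: contD; (apply: contM; first exact: cont_cst); apply: contM;
    do ?[exact: cont_snd | exact: cont_fst | apply: contB].
pose A := `[- B, B]%classic `*` `[- B, B]%classic.
have inA a b : `|a| <= B -> `|b| <= B -> A (a, b).
  by rewrite !ler_norml => ha hb; split; rewrite /= in_itv.
have A0 : A (0, 0) by apply: inA; rewrite normr0.
have cA : compact A by apply: compact_setX; exact: segment_compact.
have [[a b] + minA] := compact_EVT_min (ex_intro _ _ A0) cA (continuous_subspaceT cPhi).
rewrite inE => -[/= aB bB].
have minP a' b' : `|a'| <= B -> `|b'| <= B -> Phi (a, b) <= Phi (a', b').
  by move=> ha hb; apply: minA; rewrite inE; exact: inA.
have P00 : Phi (0, 0) = u 0 - v 0 by rewrite /Phi /= subrr !mulr0 addr0 addr0.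
have Pmin : n * (a - b) ^+ 2 + del * b ^+ 2 <= D.
  have h1 : Phi (a, b) <= Phi (0, 0) by apply: minP; rewrite normr0.
  have h2 := uC b; have := vC a; rewrite ler_norml => /andP[h3 h4].
  have h5 := ler_norm (u 0); have h6 := ler_norm (- v 0); rewrite normrN in h6.
  by move: h1; rewrite P00 /Phi /= -!expr2 /D; clear - h2 h4 h5 h6; lra.
have sq1 : 0 <= n * (a - b) ^+ 2 by rewrite mulr_ge0 ?sqr_ge0 // ltW.
have sq2 : 0 <= del * b ^+ 2 by rewrite mulr_ge0 ?sqr_ge0 // ltW.
have sq3 : del * (a - b) ^+ 2 <= n * (a - b) ^+ 2 by rewrite ler_wpM2r ?sqr_ge0.
have small y : del * y ^+ 2 <= D -> `|y| < s.
  move=> h; rewrite ltNge; apply/negP => sy.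
  have : s ^+ 2 <= y ^+ 2 by rewrite -(real_normK (num_real y)) lerXn2r ?nnegrE // (le_trans ler01).
  move=> h'; have h1 : del * s ^+ 2 <= del * y ^+ 2 by rewrite ler_pM2l.
  by clear - h h1 sD; lra.
have bs : `|b| < s by apply: small; clear - Pmin sq1; lra.
have abs : `|a - b| < s by apply: small; clear - Pmin sq2 sq3; lra.
have aB' : `|a| < B.
  have h1 := ler_normD (a - b) b; rewrite subrK in h1; rewrite /B; clear - h1 bs abs nx0; lra.
have bB' : `|b| < B by rewrite /B; clear - bs s1 nx0; lra.
have nearB (y : R) : `|y| < B -> \forall z \near y, `|z| <= B.
  rewrite ltr_norml => h; apply: filterS (near_itv h) => z /andP[h1 h2].
  by rewrite ler_norml !ltW.
pose p := 2 * n * (a - b).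
have Fv : F a p <= c - lam * v a.
  have [C1 C1E] := is_C1_quad n 0 b.
  have -> : p = (fun s => n * (s - b) ^+ 2 + 0 * s ^+ 2)^`() a by rewrite C1E; rewrite /p; ring.
  apply: vtst => //; apply: filterS (nearB a aB') => y yB.
  by have := minP y b yB (ltW bB'); rewrite /Phi /= -!expr2; clear; lra.
have pK : `|p| <= K.
  apply: (KP a); apply: (le_trans Fv); rewrite lerD2l -mulrN ler_pM2l //.
  by have := vC a; rewrite ler_norml lerNl => /andP[].
have abd : `|b - a| < d.
  move: pK; rewrite /p normrM gtr0_norm ?mulr_gt0 // distrC => h.
  by have := le_lt_trans h nK; rewrite ltr_pM2l // mulr_gt0.
have Fu : c <= lam * u b + F b (p - 2 * del * b).
  have [C1 C1E] := is_C1_quad (- n) (- del) a.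
  have -> : p - 2 * del * b = (fun s => - n * (s - a) ^+ 2 + (- del) * s ^+ 2)^`() b.
    by rewrite C1E; rewrite /p; ring.
  rewrite -subr_ge0; apply: (su _ b C1); apply: filterS (nearB b bB') => y yB.
  have := minP a y (ltW aB') yB; rewrite /Phi /= -!expr2.
  have -> : (y - a) ^+ 2 = (a - y) ^+ 2 by ring.
  have -> : (b - a) ^+ 2 = (a - b) ^+ 2 by ring.
  by clear; lra.
have deta : `|2 * del * b| <= eta.
  rewrite -(@ler_pXn2r _ 2) ?nnegrE ?(ltW eta0) // real_normK ?num_real //.
  have -> : (2 * del * b) ^+ 2 = 4 * del * (del * b ^+ 2) by ring.
  have h1 : del * b ^+ 2 <= D by clear - Pmin sq1; lra.
  have h2 : 4 * del * (del * b ^+ 2) <= 4 * del * D by rewrite ler_pM2l ?mulr_gt0.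
  by clear - h2 del1; lra.
have Fb : F b (p - 2 * del * b) <= F b p + e.
  have := LP b (p - 2 * del * b) p pK; rewrite addrC addKr normrN => /(_ (le_trans deta eta1)).
  have h : L * `|2 * del * b| <= L * eta by rewrite ler_wpM2l.
  by clear - h etaL; lra.
have := dP b a p pK abd.
have P0 := minP x0 x0 x0B x0B; rewrite /Phi /= subrr !mulr0 add0r -!expr2 in P0.
move=> Fba.
have hk : lam * (v a - u b) <= lam * (k / 2).
  have E : e = lam * k / 4 by [].
  by clear - Fba Fb Fu Fv E; lra.
rewrite ler_pM2l // in hk.
by clear - hk P0 sq1 sq2 del2 k0; lra.
Qed.

End Comparison.

(** * Limits along ultrafilters and periodic subsolutions *)

Section Ultra.
Set Implicit Arguments.
Unset Strict Implicit.
Context {R : realType}.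
Implicit Types (F H : R -> R -> R) (u v g : R -> R) (I : set R).

Lemma ultra_cvg (T : Type) (U : set_system T) (f : T -> R) B : UltraFilter U ->
  (\forall t \near U, `|f t| <= B) -> exists l : R, f t @[t --> U] --> l.
Proof.
move=> UU fB; have := @segment_compact R (- B) B (f @ U) _.
case=> [|l [_ cl]].
  by apply: filterS fB => t; rewrite /= in_itv /= ler_norml.
exists l => N Nl; have [//|nN] := in_ultra_setVsetC (f @^-1` N) UU.
have [x [nx Nx]] := cl (~` N) N nN Nl.
by [].
Qed.

(** Continuity of the pointwise limit is not assumed: coercivity gives the [f t] a common Lipschitz
    constant, which the limit inherits. *)
Lemma sub_ultra (T : Type) (U : set_system T) {UF : ProperFilter U} F g
    (f : T -> R -> R) w M : good F -> continuous g -> (forall x, g x <= M) ->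
  (forall e, 0 < e -> \forall t \near U, sub F (fun x => g x + e) setT (f t)) ->
  (forall x, f t x @[t --> U] --> w x) -> sub F g setT w.
Proof.
move=> gF cg gM sf fw.
have [K K0 KP] := good_bound (M + 1) gF.
have fK y z : y <= z -> \forall t \near U, `|f t z - f t y| <= K * (z - y).
  move=> yz; apply: filterS (sf 1 ltr01) => t st.
  apply: (sub_lip st) => // s p _ Fs; apply: (KP s); apply: (le_trans Fs).
  by rewrite lerD2r.
have wK y z : y <= z -> `|w z - w y| <= K * (z - y).
  move=> yz; have h : `|f t z - f t y| @[t --> U] --> `|w z - w y|.
    by apply: cvg_norm; apply: (@cvgB _ _ _ U _ (f ^~ z) (f ^~ y)).
  exact: (lim_le h (fK y z yz)).
have cw : continuous w.
  apply/continuous_distP => x e e0; exists (e / K) => [|y xy]; first exact: divr_gt0.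
  apply: (@le_lt_trans _ _ (K * `|x - y|)); last by rewrite mulrC -ltr_pdivlMr.
  have [h|h] := leP x y.
    by rewrite distrC (distrC x) (@ger0_norm _ (y - x)) ?subr_ge0 //; exact: wK.
  by rewrite (@gtr0_norm _ (x - y)) ?subr_gt0 //; apply: wK; exact: ltW.
apply: sub_le_eps => // e e0.
exact: (sub_limit cw (sf e e0) fw).
Qed.

(** One ultrafilter serves all points [x], in place of a diagonal extraction. *)
Lemma ultra_limit (T : Type) (U0 : set_system T) {UF : ProperFilter U0}
    (f : T -> R -> R) (B : R -> R) :
  (forall x, \forall t \near U0, `|f t x| <= B x) ->
  exists U : set_system T, [/\ UltraFilter U, U0 `<=` U &
    exists w : R -> R, forall x, f t x @[t --> U] --> w x].
Proof.
move=> fB; have [U [UU sU]] := ultraFilterLemma UF.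
exists U; split=> //.
have h x : exists l : R, f t x @[t --> U] --> l.
  by apply: (@ultra_cvg _ U (f ^~ x) (B x) UU); apply: sU; exact: fB.
by have [w wP] := choice h; exists w.
Qed.

End Ultra.

(** * Drifts of subsolutions of a periodic Hamiltonian *)

Section Drift.
Set Implicit Arguments.
Unset Strict Implicit.
Context {R : realType}.
Implicit Types (F H : R -> R -> R) (u v g : R -> R) (I : set R).

Definition periodic1 H := forall x p, H (x + 1) p = H x p.

Lemma periodic1_int H (k : int) : periodic1 H -> (fun x p => H (x + k%:~R) p) = H.
Proof.
move=> pH; have pn (n : nat) x p : H (x + n%:R) p = H x p.
  by elim: n => [|n IH]; rewrite ?addr0 // -addn1 natrD addrA pH.
apply/funext => x; apply/funext => p; case: k => n; first exact: pn.
by rewrite NegzE mulrNz -[in RHS](subrK n.+1%:R x) pn.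
Qed.

(* By gluing, the possible drifts are exactly the increments of subsolutions
   over one period. *)
Definition has_drift H a A : Prop := exists2 P : R -> R,
  sub H (fun=> a) setT P & forall x, P (x + 1) = P x + A.

Lemma sub_local_eq F g u : good F -> continuous g ->
  (forall x : R, exists2 I : set R, (\forall s \near x, I s) &
     exists2 v, sub F g I v & forall s, I s -> v s = u s) -> sub F g setT u.
Proof.
move=> gF cg h.
have cu : continuous u.
  move=> x; have [I nI [v [cv _] vu]] := h x.
  rewrite /continuous_at -(vu x (nbhs_singleton nI)).
  apply: cvg_trans (cv x); apply: near_eq_cvg.
  by apply: filterS nI => s Is; rewrite vu.
apply: sub_local => // x; have [I nI [v sv vu]] := h x.
by exists I => //; exact: sub_eq vu.
Qed.

Lemma sub_shift_int H a (k : int) I v : periodic1 H -> sub H (fun=> a) I v ->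
  sub H (fun=> a) [set x | I (x + k%:~R)] (fun x => v (x + k%:~R)).
Proof. by move=> pH /(sub_shift k%:~R); rewrite periodic1_int. Qed.

(** The integer translates of [v], raised by multiples of [A], agree at the common endpoints of
    their windows; near any point two consecutive ones are spliced. *)
Lemma drift_window H a y v : good H -> periodic1 H ->
  sub H (fun=> a) [set x | y <= x <= y + 1] v -> has_drift H a (v (y + 1) - v y).
Proof.
move=> gH pH sv; set A := _ - _.
pose P x := v (x - (Num.floor (x - y))%:~R) + A * (Num.floor (x - y))%:~R.
have floorD1 x : Num.floor (x + 1 - y) = Num.floor (x - y) + 1.
  by rewrite addrAC floorDrz ?intr1 // floor1.
exists P; last first.
  move=> x; rewrite /P floorD1 intrD.
  have -> : x + 1 - ((Num.floor (x - y))%:~R + 1) = x - (Num.floor (x - y))%:~R by ring.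
  ring.
pose piece (k : int) x := v (x - k%:~R) + A * k%:~R.
have PE (k : int) x : y + k%:~R <= x <= y + k%:~R + 1 -> piece k x = P x.
  move=> /andP[h1]; rewrite le_eqVlt => /orP[/eqP ->|h2].
    rewrite /P /piece.
    have -> : y + k%:~R + 1 - y = (k + 1)%:~R by rewrite intrD; ring.
    rewrite intrKfloor intrD.
    have -> : y + k%:~R + 1 - k%:~R = y + 1 by ring.
    have -> : y + k%:~R + 1 - (k%:~R + 1) = y by ring.
    by rewrite /A; ring.
  have : Num.floor (x - y) = k.
    by apply/eqP; rewrite floor_eq ?num_real //; apply/andP; split; rewrite ?intrD; lra.
  by rewrite /P /piece => ->.
have sp (k : int) : sub H (fun=> a) [set x | y + k%:~R <= x <= y + k%:~R + 1] (piece k).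
  apply: sub_addc; have := @sub_shift_int H a (- k) _ v pH sv; rewrite mulrNz.
  by move/sub_le; apply => // s /= /andP[h1 h2]; apply/andP; split; lra.
apply: sub_local_eq => //; first exact: cont_cst.
move=> x; pose k := Num.floor (x - y).
have hk1 : k%:~R <= x - y by exact: floor_le_tmp.
have hk2 : x - y < k%:~R + 1 by have := floorD1_gt (x - y); rewrite intrD.
pose X := y + k%:~R.
exists [set s | y + k%:~R - 1 <= s <= y + k%:~R + 1].
  have h : y + k%:~R - 1 < x < y + k%:~R + 1 by apply/andP; split; lra.
  by apply: filterS (near_itv h) => s /andP[h1 h2]; rewrite /= !ltW.
have km : (k - 1)%:~R = k%:~R - 1 :> R by rewrite intrB.
exists (splice X (piece (k - 1)) (piece k)); last first.
  move=> s /= /andP[h1 h2]; rewrite /splice; case: leP => h.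
    by apply: PE; rewrite km; apply/andP; split; rewrite /X in h; lra.
  by apply: PE; apply/andP; split; rewrite /X in h; lra.
apply: sub_splice.
- by rewrite !PE // ?km; apply/andP; split; rewrite /X; lra.
- apply: sub_le (sp (k - 1)) _ _ => // s [/andP[h1 h2] h3].
  by rewrite /= km; apply/andP; split; rewrite /= /X in h3; lra.
- apply: sub_le (sp k) _ _ => // s [/andP[h1 h2] h3].
  by apply/andP; split; rewrite /= /X in h3; lra.
Qed.

Lemma drift_conv H a1 a2 A1 A2 t : good H -> has_drift H a1 A1 -> has_drift H a2 A2 -> 0 <= t <= 1 ->
  has_drift H (t * a1 + (1 - t) * a2) (t * A1 + (1 - t) * A2).
Proof.
move=> gH [P1 s1 E1] [P2 s2 E2] t01.
exists (fun x => t * P1 x + (1 - t) * P2 x).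
  have := sub_conv gH _ _ s1 s2 t01; apply; exact: cont_cst.
by move=> x; rewrite E1 E2; ring.
Qed.

Lemma drift_between H a A1 A2 A : good H -> has_drift H a A1 -> has_drift H a A2 -> A1 <= A <= A2 -> has_drift H a A.
Proof.
move=> gH h1 h2 /andP[AA1 AA2].
have [E|ne] := eqVneq A1 A2.
  by have -> : A = A1 by apply/eqP; rewrite eq_le AA1 andbT E.
have d0 : 0 < A2 - A1 by rewrite subr_gt0 lt_neqAle ne (le_trans AA1).
pose t := (A2 - A) / (A2 - A1).
have tE : t * (A2 - A1) = A2 - A by rewrite /t mulfVK // gt_eqF.
have t01 : 0 <= t <= 1.
  by rewrite /t divr_ge0 ?subr_ge0 ?(le_trans AA1) //= ler_pdivrMr // mul1r; lra.
have := drift_conv gH h1 h2 t01.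
by have -> : t * a + (1 - t) * a = a; [ring|have -> : t * A1 + (1 - t) * A2 = A; [lra|]].
Qed.

Lemma sublevel_tilt F a a' : good F -> a < a' -> exists2 e0, 0 < e0 &
  forall e s p, `|e| <= e0 -> F s p <= a -> F s (p + e) <= a'.
Proof.
move=> gF aa; have [K _ KP] := good_bound a gF; have [L L0 LP] := good_lip K gF.
have L1 : 0 < L + 1 by lra.
exists (Num.min 1 ((a' - a) / (L + 1))).
  by rewrite lt_min ltr01 divr_gt0 // subr_gt0.
move=> e s p; rewrite le_min => /andP[e1 e2] Fs.
have := LP s (p + e) p (KP s p Fs); rewrite addrC addKr => /(_ e1).
by move: e2; rewrite ler_pdivlMr // mulrDr mulr1 (mulrC _ L) addrC; have := normr_ge0 e; lra.
Qed.

(** Slack in the level buys drift: a line of small slope of either sign can be added. *)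
Lemma drift_tilt H a a' : good H -> a < a' -> exists2 e0, 0 < e0 &
  forall e A, `|e| <= e0 -> has_drift H a A -> has_drift H a' (A + e).
Proof.
move=> gH aa; have [e0 e00 eP] := sublevel_tilt gH aa; exists e0 => // e A ee [P sP E].
exists (fun x => P x + e * x); last by move=> x; rewrite E; ring.
by apply: (sub_add_line sP) => s p _; exact: eP.
Qed.

(** The normalisation at 0 and the common Lipschitz constant bound [f e x] by [K * |x|],
    independently of small [e]. *)
Lemma level_limit F a (f : R -> R -> R) : good F ->
  (forall e, 0 < e -> sub F (fun=> a + e) setT (f e) /\ f e 0 = 0) ->
  exists U : set_system R, [/\ UltraFilter U, 0^'+ `<=` U &
    exists2 w : R -> R, sub F (fun=> a) setT w & forall x, f t x @[t --> U] --> w x].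
Proof.
move=> gF fP; have [K K0 KP] := good_bound (a + 1) gF.
have sf e : 0 < e -> \forall t \near 0^'+, sub F (fun=> a + e) setT (f t).
  move=> e0; near=> t.
  have [] := fP t; first by near: t; exact: nbhs_right_gt.
  move=> st _; apply: sub_le st _ _ => // s _; rewrite lerD2l.
  by near: t; exact: nbhs_right_le.
have fB x : \forall t \near 0^'+, `|f t x| <= K * `|x|.
  near=> t; have t0 : 0 < t by near: t; exact: nbhs_right_gt.
  have [st f0] := fP t t0.
  have Kt s p : setT s -> F s p <= a + t -> `|p| <= K.
    move=> _ Hs; apply: (KP s); apply: (le_trans Hs); rewrite lerD2l.
    by near: t; exact: nbhs_right_le.
  have [x0|x0] := leP 0 x.
    by have := sub_lip st Kt x0 (fun s _ => I); rewrite f0 !subr0 (ger0_norm x0).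
  have := sub_lip st Kt (ltW x0) (fun s _ => I).
  by rewrite f0 !sub0r normrN (ltr0_norm x0).
have [U [UU sU [w fw]]] := ultra_limit fB.
have UF : ProperFilter U by exact: ultra_proper.
exists U; split=> //; exists w => //.
apply: (@sub_ultra _ _ U _ _ _ f _ a) => //; first exact: cont_cst.
by move=> e e0; apply: sU; exact: sf.
Unshelve. all: by end_near. Qed.

Lemma drift_lim0 H a : good H -> (forall e, 0 < e -> exists2 A, `|A| <= e & has_drift H (a + e) A) ->
  has_drift H a 0.
Proof.
move=> gH h.
have /choice[f fP] : forall e, exists P : R -> R, 0 < e ->
    [/\ sub H (fun=> a + e) setT P, P 0 = 0 & forall x, `|P (x + 1) - P x| <= e].
  move=> e; have [e0|] := ltP 0 e; last by exists (fun=> 0).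
  have [A Ae [P sP E]] := h e e0.
  exists (fun x => P x - P 0) => _; split; first exact: sub_addc.
    by rewrite subrr.
  by move=> x; rewrite E; have -> : P x + A - P 0 - (P x - P 0) = A by ring.
have [e|U [UU sU [w sw fw]]] := @level_limit H a f gH; first by case/fP.
have UF : ProperFilter U by exact: ultra_proper.
exists w => // x; rewrite addr0; apply/eqP; rewrite -subr_eq0 -normr_le0.
apply/ler_addgt0Pr => e e0; rewrite add0r.
have lm : `|f t (x + 1) - f t x| @[t --> U] --> `|w (x + 1) - w x|.
  by apply: cvg_norm; apply: (@cvgB _ _ _ U _ (f ^~ (x + 1)) (f ^~ x)).
apply: (lim_le lm); apply: sU; near=> t.
have [] := fP t; first by near: t; exact: nbhs_right_gt.
move=> _ _ /(_ x) /le_trans; apply; by near: t; exact: nbhs_right_le.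
Unshelve. all: by end_near. Qed.

(** If every period raised [v] by more than [e], then [v] would grow linearly and exceed the
    bound. *)
Lemma window_rise H a y v B e : good H -> periodic1 H -> 0 < e ->
  sub H (fun=> a) [set x | y <= x] v -> (forall x, y <= x -> v x - v y <= B) ->
  exists2 A, A <= e & has_drift H a A.
Proof.
move=> gH pH e0 sv vB; apply: contrapT => nA.
have rise (k : nat) : k%:R * e <= v (y + k%:R) - v y.
  elim: k => [|k IH]; first by rewrite mul0r addr0 subrr.
  have hA : has_drift H a (v (y + k%:R + 1) - v (y + k%:R)).
    apply: drift_window => //; apply: sub_le sv _ _ => // s /andP[h _].
    by apply: le_trans h; rewrite lerDl.
  have : e < v (y + k%:R + 1) - v (y + k%:R).
    by rewrite ltNge; apply/negP => h; apply: nA; exists (v (y + k%:R + 1) - v (y + k%:R)).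
  by rewrite -addrA natr1; have := IH; rewrite -natr1; lra.
pose k := Num.bound (`|B| / e).
have hk : `|B| / e < k%:R by apply: archi_boundP; rewrite divr_ge0 // ltW.
have := vB (y + k%:R); rewrite lerDl ler0n => /(_ isT).
rewrite ltr_pdivrMr // in hk; have := rise k; have := ler_norm B; lra.
Qed.

End Drift.

(** * Periodic Hamiltonians and critical values *)

Section Hamiltonian.
Set Implicit Arguments.
Unset Strict Implicit.
Context {R : realType}.
Implicit Types (F H : R -> R -> R) (V u v g w h : R -> R) (I : set R) (c X C m : R).

Lemma periodic_shift H (x : R) : periodic1 H ->
  exists2 k : int, 0 <= x + k%:~R <= 1 & forall y p, H (y + k%:~R) p = H y p.
Proof.
move=> pH; exists (- Num.floor x).
  have h1 : (Num.floor x)%:~R <= x by exact: floor_le_tmp.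
  have h2 : x < (Num.floor x)%:~R + 1 by have := floorD1_gt x; rewrite intrD.
  by rewrite mulrNz; apply/andP; split; lra.
by move=> y p; have /(congr1 (fun f => f y p)) := periodic1_int (- Num.floor x) pH.
Qed.

(** Only [x] is confined to the compact interval and [y] may leave it, as happens when [x] is
    brought back to one period and [y] is moved along. *)
Lemma compact_unif (f : R * R -> R) (a b K e : R) : continuous f -> 0 < e ->
  exists2 d, 0 < d & forall x y p, a <= x <= b -> `|p| <= K -> `|x - y| < d ->
    `|f (x, p) - f (y, p)| < e.
Proof.
move=> cf e0.
have cA : compact (`[a, b]%classic `*` `[- K, K]%classic : set (R * R)).
  by apply: compact_setX; exact: segment_compact.
have /compact_near_coveringP cov := cA.
have e20 : 0 < e / 2 by rewrite divr_gt0.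
have := cov _ 0^'+ (fun d z => forall y, `|z.1 - y| < d -> `|f z - f (y, z.2)| < e) _ _.
move=> h; have : \forall d \near 0^'+, (`[a, b]%classic `*` `[- K, K]%classic : set (R * R))
   `<=` (fun z => forall y, `|z.1 - y| < d -> `|f z - f (y, z.2)| < e).
  apply: h => -[x p] _.
  have /cvgrPdist_lt/(_ _ e20)/nbhs_ballP[r /= r0 rP] := cf (x, p).
  have r20 : 0 < r / 2 by rewrite divr_gt0.
  exists (ball (x, p) (r / 2), [set d | d < r / 2]).
    by split; [exact: nbhsx_ballx|exact: nbhs_right_lt].
  move=> [[x' p'] d] /= [[bx bp] dr] y xy.
  have bx' : `|x - x'| < r / 2 by exact: bx.
  have bp' : `|p - p'| < r / 2 by exact: bp.
  have f1 : `|f (x, p) - f (x', p')| < e / 2.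
    by apply: rP; split=> /=; rewrite /ball /=; lra.
  have f2 : `|f (x, p) - f (y, p')| < e / 2.
    apply: rP; split=> /=; rewrite /ball /=; last lra.
    have := ler_normD (x - x') (x' - y); rewrite addrA subrK; lra.
  have -> : f (x', p') - f (y, p') = (f (x, p) - f (y, p')) - (f (x, p) - f (x', p')) by ring.
  apply: le_lt_trans (ler_normB _ _) _; lra.
move=> hn; near (0 : R)^'+ => d; exists d; first by near: d; exact: nbhs_right_gt.
have hd : (`[a, b]%classic `*` `[- K, K]%classic : set (R * R))
   `<=` (fun z => forall y, `|z.1 - y| < d -> `|f z - f (y, z.2)| < e) by near: d.
move=> x y p xab pK xy; apply: (hd (x, p)) => //; split; rewrite /= in_itv //=.
by rewrite -ler_norml.
Unshelve. all: by end_near. Qed.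

Lemma good_periodic H : continuous (fun z : R * R => H z.1 z.2) ->
  (forall p : R, periodic (fun x : R => H x p) 1) ->
  (forall x : R, convex_function setT (H x : R^o -> R^o)) -> coercive H ->
  good H /\ periodic1 H.
Proof.
move=> cH pH vH coH.
have p1 : periodic1 H by move=> x p; exact: (pH p x).
split=> //; split=> //.
- move=> x p q t /andP[t0 t1].
  have := vH x (Itv01 t0 t1) p q; rewrite !inE => /(_ Logic.I Logic.I).
  by rewrite !convRE.
- move=> K e e0; have [d d0 dP] := compact_unif 0 1 K cH e0.
  exists d => // x y p pK xy.
  have [k xk Hk] := periodic_shift x p1.
  have := dP (x + k%:~R) (y + k%:~R) p xk pK.
  have -> : x + k%:~R - (y + k%:~R) = x - y by ring.
  by move=> /(_ xy) /=; rewrite !Hk => /(le_lt_trans (ler_norm _)); lra.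
- move=> K; pose A : set (R * R) := `[0, 1]%classic `*` `[- `|K|, `|K|]%classic.
  have cA : compact A by apply: compact_setX; exact: segment_compact.
  have A0 : A !=set0.
    by exists (0, 0); split; rewrite /= in_itv /= ?lexx ?ler01 // oppr_le0 normr_ge0.
  have [z1 _ z1P] := compact_EVT_max A0 cA (continuous_subspaceT cH).
  have [z2 _ z2P] := compact_EVT_min A0 cA (continuous_subspaceT cH).
  exists (`|H z1.1 z1.2| + `|H z2.1 z2.2|) => x p pK.
  have [k xk Hk] := periodic_shift x p1.
  have zA : (x + k%:~R, p) \in A.
    rewrite inE; split; rewrite /= in_itv //= -ler_norml.
    exact: le_trans pK (ler_norm _).
  have := z1P _ zA; have := z2P _ zA; rewrite /= Hk => h1 h2.
  have h3 := ler_norm (H z1.1 z1.2); have h4 := ler_norm (- H z2.1 z2.2); rewrite normrN in h4.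
  have h5 := normr_ge0 (H z1.1 z1.2); have h6 := normr_ge0 (H z2.1 z2.2).
  by rewrite ler_norml; apply/andP; split; clear - h1 h2 h3 h4 h5 h6; lra.
Qed.

Lemma compact_support_zero V : compact_support V ->
  exists2 X, 0 <= X & forall x, X <= `|x| -> V x = 0.
Proof.
move=> /compact_bounded[M [_ MP]]; exists (`|M| + 2) => [|x Xx]; first exact: addr_ge0.
apply/eqP; rewrite -[_ == _]negbK; apply/negP => Vx.
have : M < `|M| + 1 by have := ler_norm M; lra.
move=> /MP/(_ x) h; have : `|x| <= `|M| + 1 by apply: h; exact: subset_closure.
lra.
Qed.

Lemma compact_support_unif V (e : R) : continuous V -> compact_support V -> 0 < e ->
  exists2 d, 0 < d & forall x y, `|x - y| < d -> `|V x - V y| < e.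
Proof.
move=> cV /compact_support_zero[X X0 VX] e0.
have cf : continuous (fun z : R * R => V z.1) by apply: cont_comp => //; exact: cont_fst.
have [d d0 dP] := compact_unif (- X - 1) (X + 1) 0 cf e0.
exists (Num.min d 1); first by rewrite lt_min d0 ltr01.
move=> x y; rewrite lt_min => /andP[xd x1].
have [xX|xX] := leP `|x| (X + 1).
  apply: (dP x y 0) => //; last by rewrite normr0.
  by move: xX; rewrite ler_norml opprD.
rewrite !VX ?subrr ?normr0 //; last by lra.
by have := ler_normD (x - y) y; rewrite subrK; lra.
Qed.

Lemma good_sub H V : good H -> continuous V -> compact_support V ->
  good (fun x p => H x p - V x).
Proof.
move=> gH cV sV.
have [BV BVP] : exists B, forall x, `|V x| <= B.
  have [X X0 VX] := compact_support_zero sV.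
  have XX : - X <= X by lra.
  have [a _ aP] := EVT_max XX (continuous_subspaceT cV).
  have [b _ bP] := EVT_min XX (continuous_subspaceT cV).
  exists (`|V a| + `|V b|) => x; have [xX|xX] := leP `|x| X; last first.
    by rewrite VX ?normr0 ?addr_ge0 // ltW.
  have xI : x \in `[- X, X]%R by rewrite in_itv /= -ler_norml.
  have h1 := aP x xI; have h2 := bP x xI.
  have h3 := ler_norm (V a); have h4 := ler_norm (- V b); rewrite normrN in h4.
  have h5 := normr_ge0 (V a); have h6 := normr_ge0 (V b).
  by rewrite ler_norml; apply/andP; split; clear - h1 h2 h3 h4 h5 h6; lra.
split.
- move=> x p q t t01; have := good_convex gH x p q t01; lra.
- move=> M; have [K KP] := good_coercive gH (M + BV); exists K => x p pK.
  have := KP x p pK; have := BVP x; rewrite ler_norml => /andP[_ h]; lra.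
- move=> K e e0; have e20 : 0 < e / 2 by rewrite divr_gt0.
  have [d1 d10 d1P] := good_unif gH K e20.
  have [d2 d20 d2P] := compact_support_unif cV sV e20.
  exists (Num.min d1 d2); first by rewrite lt_min d10.
  move=> x y p pK; rewrite lt_min => /andP[h1 h2].
  have := d1P x y p pK h1; have := d2P x y h2; rewrite ltr_norml => /andP[h3 h4]; lra.
- move=> K; have [M MP] := good_bdd gH K; exists (M + BV) => x p pK.
  by apply: le_trans (ler_normB _ _) _; apply: lerD => //; exact: MP.
Qed.

Lemma good_mirr F : good F -> good (mirr F).
Proof.
move=> gF; split.
- move=> x p q t t01; rewrite /mirr.
  have -> : - (t * p + (1 - t) * q) = t * - p + (1 - t) * - q by ring.
  exact: (good_convex gF).
- move=> M; have [K KP] := good_coercive gF M; exists K => x p pK.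
  by apply: KP; rewrite normrN.
- move=> K e e0; have [d d0 dP] := good_unif gF K e0; exists d => // x y p pK xy.
  by apply: dP; rewrite ?normrN //; have -> : - x - - y = - (x - y) by [ring]; rewrite normrN.
- by move=> K; have [M MP] := good_bdd gF K; exists M => x p pK; apply: MP; rewrite normrN.
Qed.

Lemma mirrK F : mirr (mirr F) = F.
Proof. by apply/funext => x; apply/funext => p; rewrite /mirr !opprK. Qed.

Lemma periodic1_mirr H : periodic1 H -> periodic1 (mirr H).
Proof.
by move=> pH x p; rewrite /mirr -[LHS]pH; congr H; ring.
Qed.

Lemma drift_mirr H a A : has_drift H a A -> has_drift (mirr H) a (- A).
Proof.
move=> [P sP EP]; exists (fun x => P (- x)); first exact: sub_le (sub_mirror sP) _ _.
by move=> x; have := EP (- (x + 1)); have -> : - (x + 1) + 1 = - x by [ring]; lra.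
Qed.

Lemma sub_mirrorT F a v : sub (mirr F) (fun=> a) setT v -> sub F (fun=> a) setT (fun x => v (- x)).
Proof. by move=> /sub_mirror; rewrite mirrK => /sub_le; apply. Qed.

Lemma supersol_mirror F m c u : visc_supersol (discounted m F c) u ->
  visc_supersol (discounted m (mirr F) c) (fun x => u (- x)).
Proof.
move=> [cu su]; split; first exact: continuous_mirror.
move=> phi x Cphi tch; have [C' E'] := is_C1_mirror Cphi.
have := su _ (- x) C'; rewrite E' opprK /discounted /mirr; apply.
have := near_opp tch; apply: filterS => y.
by rewrite opprK.
Qed.

Lemma visc_subP F a u : good F -> visc_subsol (stationary F a) u <-> sub F (fun=> a) setT u.
Proof.
move=> gF; split=> [[cu h]|su].
  apply: vtest_sub => // x _ phi C t; have := h phi x C t.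
  by rewrite /stationary subr_le0.
split; first exact: proj1 su.
move=> phi x C t; rewrite /stationary subr_le0.
exact: (sub_vtest gF su (@cont_cst R R a) filterT C t).
Qed.

Lemma bounded_fun_exP u : bounded_fun u <-> exists B, forall x, `|u x| <= B.
Proof.
split=> [[M [_ MP]]|[B BP]].
  exists (`|M| + 1) => x; apply: (MP (`|M| + 1)) => //; have := ler_norm M; lra.
exists B; split; first exact: num_real.
by move=> M BM x _; apply: le_trans (BP x) (ltW BM).
Qed.

Lemma discounted_sub F m c u : visc_subsol (discounted m F c) u ->
  sub F (fun x => c - m * u x) setT u.
Proof.
move=> [cu h]; apply: vtest_sub => // x _ phi C t; have := h phi x C t.
by rewrite /discounted; lra.
Qed.

(** [inf] bounds its set from below only if the set has a lower bound; a difference quotient at 0 of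
    any subsolution shows that a lower bound of [F] is one. *)
Lemma crit_le F a v B : good F -> sub F (fun=> a) setT v -> (forall x, `|v x| <= B) ->
  crit F <= a.
Proof.
move=> gF sv vB; apply: ge_inf; last first.
  by exists v; [exact/visc_subP|apply/bounded_fun_exP; exists B].
have [m mP] := good_lbound gF; exists m => b [u /(visc_subP _ _ gF) su _].
apply/ler_addgt0Pr => e e0.
have [r r0 rP] := sub_quot_near (x := 0) gF su (@cont_cst R R b) filterT e0.
have r20 : 0 < r / 2 by rewrite divr_gt0.
have := rP 0 (r / 2); rewrite subrr normr0 subr0 (gtr0_norm r20) => /(_ r0 _ r20).
have h : r / 2 < r by lra.
by move=> /(_ h); apply: le_trans.
Qed.

Lemma crit_adherent F e : good F -> 0 < e ->
  exists v B, sub F (fun=> crit F + e) setT v /\ forall x, `|v x| <= B.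
Proof.
move=> gF e0; have [M MP] := good_bdd gF 0.
have : has_inf [set a : R | exists2 u : R -> R, visc_subsol (stationary F a) u & bounded_fun u].
  split.
    (* A constant is a subsolution at any level above [F (., 0)], so the set is nonempty. *)
    exists M, (fun x => 0 * x + 0); last first.
      by apply/bounded_fun_exP; exists 0 => x; rewrite mul0r addr0 normr0.
    apply/visc_subP => //; split.
      by apply: contD; [apply: contM; [exact: cont_cst|exact: cont_id]|exact: cont_cst].
    move=> y z yz _; have F0 : F y 0 <= M.
      by apply: le_trans (ler_norm _) _; apply: MP; rewrite normr0.
    have yy : y <= y <= z by rewrite lexx ltW.
    rewrite !mul0r subrr; split=> b hb.
      by apply: mulr_ge0; [exact: (hb y)|rewrite subr_ge0 ltW].
    by apply: mulr_le0_ge0; [exact: (hb y)|rewrite subr_ge0 ltW].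
  have [m mP] := good_lbound gF; exists m => b [u /(visc_subP _ _ gF) su _].
  apply/ler_addgt0Pr => k k0.
  have [r r0 rP] := sub_quot_near (x := 0) gF su (@cont_cst R R b) filterT k0.
  have r20 : 0 < r / 2 by rewrite divr_gt0.
  have := rP 0 (r / 2); rewrite subrr normr0 subr0 (gtr0_norm r20) => /(_ r0 _ r20).
  have h : r / 2 < r by lra.
  by move=> /(_ h); apply: le_trans.
move=> /(inf_adherent e0)[a [v sv /bounded_fun_exP[B vB]] ae].
exists v, B; split=> //; move/(visc_subP _ _ gF): sv => /sub_le; apply => // s _.
exact: ltW.
Qed.

End Hamiltonian.

(** * Behaviour near the right end *)

Section RightEnd.
Set Implicit Arguments.
Unset Strict Implicit.
Context {R : realType}.
Implicit Types (F H : R -> R -> R) (V u v g w : R -> R) (I : set R) (c X C m : R).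

Definition pert H V : R -> R -> R := fun x p => H x p - V x.

(* [V] is only required to vanish near [+oo], so that the same statements apply
   to the reflected problem and to its left end. *)
Record setup H V c X C (sol : R -> R -> R) : Prop := Setup {
  st_H : good H;
  st_per : periodic1 H;
  st_F : good (pert H V);
  st_V : forall x, X <= x -> V x = 0;
  st_drift0 : has_drift H c 0;
  st_wb : exists2 wb : R -> R, sub (pert H V) (fun=> c) setT wb & forall x, `|wb x| <= C;
  st_sub : forall m, 0 < m <= 1 -> sub (pert H V) (fun x => c - m * sol m x) setT (sol m);
  st_sup : forall m, 0 < m <= 1 -> visc_supersol (discounted m (pert H V) c) (sol m);
  st_bdd : forall m, 0 < m <= 1 -> exists B, forall x, `|sol m x| <= B;
  st_lb : forall m x, 0 < m <= 1 -> - C <= sol m x }.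

Lemma setup_C0 H V c X C sol : setup H V c X C sol -> 0 <= C.
Proof. by move=> S; have [wb _ hC] := st_wb S; exact: le_trans (normr_ge0 _) (hC 0). Qed.

Lemma subF_right H V c X C sol g I v : setup H V c X C sol -> (forall x, I x -> X <= x) ->
  sub (pert H V) g I v -> sub H g I v.
Proof.
move=> S IX /sub_le_eq; apply => s p Is.
by rewrite /pert (st_V S) ?subr0 //; exact: IX.
Qed.

Lemma subH_right H V c X C sol g I v : setup H V c X C sol -> (forall x, I x -> X <= x) ->
  sub H g I v -> sub (pert H V) g I v.
Proof.
move=> S IX /sub_le_eq; apply => s p Is.
by rewrite /pert (st_V S) ?subr0 //; exact: IX.
Qed.

(** The lower bound on the solutions is enough: for [m <= 1] the level [c - m * sol m x] is at most
    [c + C], and coercivity bounds the slopes independently of [m]. *)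
Lemma setup_lip H V c X C sol : setup H V c X C sol -> exists2 K, 0 < K &
  forall m y z, 0 < m <= 1 -> `|sol m z - sol m y| <= K * `|z - y|.
Proof.
move=> S; have C0 := setup_C0 S; have [K K0 KP] := good_bound (c + C) (st_F S).
exists K => // m y z m01.
wlog yz : y z / y <= z.
  move=> h; have [|/ltW h'] := leP y z; first exact: h.
  by rewrite distrC (distrC z); exact: h.
rewrite (@ger0_norm _ (z - y)) ?subr_ge0 //.
apply: (sub_lip (st_sub S m01)) => // s p _ Fs; apply: (KP s); apply: (le_trans Fs).
rewrite lerD2l -mulrN; have [m0 m1] := andP m01.
have h : - sol m s <= C by rewrite lerNl; exact: (st_lb S).
have : m * - sol m s <= m * C by rewrite ler_pM2l.
have : m * C <= 1 * C by rewrite ler_wpM2r.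
lra.
Qed.

Lemma loc_unif (U : set_system R) (sol : R -> R -> R) w K a b e : ProperFilter U -> 0 < K ->
  (\forall m \near U, 0 < m <= 1) ->
  (forall m y z, 0 < m <= 1 -> `|sol m z - sol m y| <= K * `|z - y|) ->
  (forall x, sol m x @[m --> U] --> w x) -> 0 < e ->
  \forall m \near U, forall x, a <= x <= b -> `|w x - sol m x| <= e.
Proof.
move=> UF K0 U01 uK uw e0.
have wK y z : `|w z - w y| <= K * `|z - y|.
  have h : `|sol m z - sol m y| @[m --> U] --> `|w z - w y|.
    by apply: cvg_norm; apply: (@cvgB _ _ _ U _ (sol ^~ z) (sol ^~ y)).
  by apply: (lim_le h); apply: filterS U01 => m; exact: uK.
have /compact_near_coveringP cov := @segment_compact R a b.
have := cov _ U (fun m x => `|w x - sol m x| <= e) _ _.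
move=> h; have h' : \forall m \near U, `[a, b]%classic `<=` (fun x => `|w x - sol m x| <= e).
  apply: h => x _.
  pose d := e / (3 * K); have d0 : 0 < d by rewrite divr_gt0 // mulr_gt0.
  have Kd : K * d = e / 3 by rewrite /d; field; rewrite gt_eqF.
  have e30 : 0 < e / 3 by rewrite divr_gt0.
  have N1 : \forall x' \near x, `|x - x'| < d by apply/nbhs_ballP; exists d.
  have N2 : \forall m \near U, `|w x - sol m x| < e / 3.
    by have /cvgrPdist_lt/(_ _ e30) := uw x.
  exists ([set x' | `|x - x'| < d], [set m | `|w x - sol m x| < e / 3 /\ 0 < m <= 1]).
    by split=> //=; apply: filterI.
  move=> [x' m] /= [xx [wu m01]].
  have h1 := wK x' x; have h2 := uK m x' x m01.
  have h3 : K * `|x - x'| <= K * d by rewrite ler_pM2l // ltW.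
  have -> : w x' - sol m x' = - (w x - w x') + (w x - sol m x) + (sol m x - sol m x') by ring.
  apply: (le_trans (ler_normD _ _)); have := ler_normD (- (w x - w x')) (w x - sol m x).
  by rewrite normrN; lra.
by apply: filterS h' => m hm x xab; apply: hm; rewrite /= in_itv.
Qed.

(** Without negative drifts no height is lost over a full period, so only the last incomplete period
    counts. *)
Lemma drop_le H c K x y v : good H -> periodic1 H ->
  ~ (exists2 A, A < 0 & has_drift H c A) -> (forall s p, H s p <= c -> `|p| <= K) ->
  0 <= K -> x <= y -> sub H (fun=> c) [set s | x <= s <= y] v -> v x - v y <= K.
Proof.
move=> gH pH nneg HK K0 xy.
have [n] : exists n : nat, y - x <= n%:R.
  by exists (Num.bound (y - x)); apply/ltW/archi_boundP; rewrite subr_ge0.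
elim: n x xy => [|n IH] x xy hn sv.
  have -> : x = y by apply/eqP; rewrite eq_le xy /=; lra.
  by rewrite subrr.
have [h|h] := leP (y - x) 1.
  have := sub_lip sv (fun s p _ => HK s p) xy (fun s hs => hs).
  rewrite ler_norml => /andP[h1 _].
  have : K * (y - x) <= K * 1 by rewrite ler_wpM2l.
  lra.
have xy1 : x + 1 <= y by lra.
have A0 : 0 <= v (x + 1) - v x.
  rewrite leNgt; apply/negP => An; apply: nneg; exists (v (x + 1) - v x) => //.
  apply: drift_window => //; apply: sub_le sv _ _ => // s /andP[h1 h2].
  by apply/andP; split; lra.
have : v (x + 1) - v y <= K.
  apply: IH => //; first by rewrite -natr1 in hn; lra.
  apply: sub_le sv _ _ => // s /andP[h1 h2]; apply/andP; split; lra.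
lra.
Qed.

(** A solution above 1 at [x0] must come down to 1 further right: otherwise it would be a bounded
    subsolution at level [c - m] on a half-line, hence yield an arbitrarily small drift there, and
    the gap [m] would tilt it into a negative drift at level [c]. Until it reaches 1 it is a
    critical subsolution, whose descent is bounded by [drop_le]. *)
Lemma upper_right H V c X C sol : setup H V c X C sol ->
  ~ (exists2 A, A < 0 & has_drift H c A) ->
  exists D, forall m x, 0 < m <= 1 -> X <= x -> sol m x <= D.
Proof.
move=> S nneg; have [K K0 KP] := good_bound c (st_H S).
exists (K + 2) => m x0 m01 Xx0; have [m0 m1] := andP m01.
have [|ux0] := leP (sol m x0) 1; first lra.
set v := sol m in ux0 *.
have sv := st_sub S m01; have cv : continuous v := proj1 sv.
have right (I : set R) : (forall s, I s -> x0 <= s) -> forall k, (forall s, I s -> k <= v s) ->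
    sub H (fun=> c - m * k) I v.
  move=> Ix k Ik; apply: (subF_right S) => [s /Ix|]; first exact: le_trans.
  by apply: sub_le sv _ _ => // s Is; rewrite lerD2l lerN2 ler_pM2l //; exact: Ik.
have [y1 xy1 vy1] : exists2 y, x0 <= y & v y <= 1.
  apply: contrapT => ny.
  have v1 s : x0 <= s -> 1 <= v s.
    by move=> xs; rewrite leNgt; apply/negP => /ltW h; apply: ny; exists s.
  have sv1 : sub H (fun=> c - m * 1) [set s | x0 <= s] v by apply: right.
  have cm : c - m * 1 < c by rewrite mulr1 gtrDl oppr_lt0.
  have [e0 e00 e0P] := drift_tilt (st_H S) cm.
  have [B BP] := st_bdd S m01.
  have e02 : 0 < e0 / 2 by rewrite divr_gt0.
  have [|A Ae AP] := @window_rise _ H _ x0 v (2 * B) _ (st_H S) (st_per S) e02 sv1.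
    move=> x _; have := BP x; have := BP x0; rewrite !ler_norml => /andP[h1 h2] /andP[h3 h4].
    by rewrite /v; lra.
  apply: nneg; exists (A + - e0); first lra.
  by apply: e0P => //; rewrite normrN gtr0_norm.
pose A := `[x0, y1]%classic `&` (v @^-1` [set z | z <= 1]).
have cA : compact A.
  apply: compact_closedI; first exact: segment_compact.
  by apply: closed_comp; [move=> ? _; exact: cv|exact: closed_le].
have A0 : A !=set0 by exists y1; split; rewrite //= in_itv /= xy1 lexx.
have [y] := compact_EVT_min A0 cA (continuous_subspaceT cont_id).
rewrite inE => -[]; rewrite /= in_itv /= => /andP[x0y yy1] vy ymin.
have {}ymin s : x0 <= s < y -> 1 <= v s.
  move=> /andP[h1 h2]; rewrite leNgt; apply/negP => h.
  have : s \in A.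
    by rewrite inE; split; rewrite /= ?in_itv /= ?h1 ?(ltW h) //=; lra.
  by move/ymin; rewrite leNgt h2.
have x0y' : x0 < y.
  by rewrite lt_neqAle x0y andbT; apply/eqP => E; rewrite E in ux0; lra.
have /continuous_distP/(_ y 1 ltr01)[d d0 dP] := cv.
(* Only points before [y] are known to satisfy [1 <= v], so the descent is measured up to [y'];
   continuity costs one more unit, whence [K + 2]. *)
pose y' := Num.max x0 (y - d / 2).
have [h1 h2] : x0 <= y' /\ y - d / 2 <= y' by rewrite /y' !le_max !lexx orbT.
have h3 : y' < y by rewrite /y' gt_max x0y' /=; lra.
have : `|v y - v y'| < 1 by apply: dP; rewrite gtr0_norm; lra.
rewrite ltr_distl => /andP[h4 h5].
have : v x0 - v y' <= K.
  apply: (drop_le (st_H S) (st_per S) nneg KP (ltW K0) h1).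
  have := right [set s | x0 <= s <= y'] _ 0; rewrite mulr0 subr0; apply => s /andP[a1 a2] //.
  by apply: (le_trans ler01); apply: ymin; apply/andP; split; lra.
lra.
Qed.

Lemma quasi_bound (P : R -> R) A : continuous P -> (forall x, P (x + 1) = P x + A) ->
  exists2 B, 0 <= B & forall x, `|P x - A * x| <= B.
Proof.
move=> cP EP; pose p x := P x - A * x.
have cp : continuous p by apply: contB => //; apply: contM; [exact: cont_cst|exact: cont_id].
have pp : periodic1 (fun x (_ : R) => p x) by move=> x _; rewrite /p EP; ring.
have [a _ aP] := EVT_max (@ler01 R) (continuous_subspaceT cp).
have [b _ bP] := EVT_min (@ler01 R) (continuous_subspaceT cp).
exists (`|p a| + `|p b|) => [|x]; first exact: addr_ge0.
pose k := Num.floor x.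
have -> : P x - A * x = p (x - k%:~R).
  have /(congr1 (fun f => f x 0)) := @periodic1_int _ _ (- k) pp.
  by rewrite mulrNz => ->.
have xk : x - k%:~R \in `[0, 1]%R.
  rewrite in_itv /=; have h1 : k%:~R <= x by exact: floor_le_tmp.
  have h2 : x < k%:~R + 1 by have := floorD1_gt x; rewrite intrD.
  by apply/andP; split; lra.
have := aP _ xk; have := bP _ xk.
have := ler_norm (p a); have := ler_norm (- p b); rewrite normrN.
have := normr_ge0 (p a); have := normr_ge0 (p b).
by move=> h1 h2 h3 h4 h5 h6; rewrite ler_norml; apply/andP; split; lra.
Qed.

(** A solution positive on the middle interval is there a subsolution at a level [c - dl] below [c].
    Its increment [r] over the period [[X, X + 1]] is a drift at that level; mixing it with an
    opposite drift at level [c] gives zero drift at a level [a < c]. The resulting periodic function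
    continues the solution on both sides to a bounded subsolution below the critical level. *)
Lemma upper_mid H V c X C sol A1 A2 m : setup H V c X C sol -> 0 <= X ->
  (forall x, x <= - X -> V x = 0) ->
  (forall a v B, sub (pert H V) (fun=> a) setT v -> (forall x, `|v x| <= B) -> c <= a) ->
  has_drift H c A1 -> A1 < 0 -> has_drift H c A2 -> 0 < A2 -> 0 < m <= 1 ->
  exists2 x, - X <= x <= X + 1 & sol m x <= 0.
Proof.
move=> S X0 Vl hmin adm1 A10 adm2 A20 m01; have [m0 m1] := andP m01.
apply: contrapT => nx; set v := sol m in nx *.
have sv := st_sub S m01; have cv : continuous v := proj1 sv.
have XX : - X <= X + 1 by lra.
have [t] := EVT_min XX (continuous_subspaceT cv).
rewrite in_itv /= => tI tmin; pose dl := m * v t.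
have vt0 : 0 < v t by rewrite ltNge; apply/negP => h; apply: nx; exists t.
have dl0 : 0 < dl by rewrite mulr_gt0.
have sF : sub (pert H V) (fun=> c - dl) [set s | - X <= s <= X + 1] v.
  apply: sub_le sv _ _ => // s sI; rewrite lerD2l lerN2 /dl ler_pM2l //.
  by apply: tmin; rewrite in_itv.
pose r := v (X + 1) - v X.
have admr : has_drift H (c - dl) r.
  apply: drift_window; [exact: st_H S|exact: st_per S|].
  apply: (subF_right S) => [s /andP[] //|].
  by apply: sub_le sF _ _ => // s /andP[h1 h2]; apply/andP; split; lra.
(* Scales [- r] into the interval of drifts; the weight [th = s / (1 + s)] then cancels [r] against
   [- (s * r)]. *)
pose s := Num.min (- A1) A2 / (`|r| + 1).
have r1 : 0 < `|r| + 1 by rewrite ltr_wpDl.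
have mn0 : 0 < Num.min (- A1) A2 by rewrite lt_min oppr_gt0 A10.
have s0 : 0 < s by rewrite divr_gt0.
have sr : `|s * r| <= Num.min (- A1) A2.
  rewrite normrM (gtr0_norm s0).
  have : s * (`|r| + 1) = Num.min (- A1) A2 by rewrite /s mulfVK // gt_eqF.
  by rewrite mulrDr mulr1; lra.
move: sr; rewrite le_min !ler_norml => /andP[/andP[sr1 sr2] /andP[sr3 sr4]].
have admA : has_drift H c (- (s * r)).
  by apply: (drift_between (st_H S) adm1 adm2); apply/andP; split; lra.
pose th := s / (1 + s).
have s10 : 0 < 1 + s by rewrite addr_gt0.
have th0 : 0 < th by rewrite divr_gt0.
have th1 : th <= 1 by rewrite /th ler_pdivrMr // mul1r; lra.
have := drift_conv (st_H S) admr admA (t := th); rewrite (ltW th0) th1 => /(_ isT).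
have -> : th * r + (1 - th) * - (s * r) = 0 by rewrite /th; field; rewrite gt_eqF.
have -> : th * (c - dl) + (1 - th) * c = c - th * dl by ring.
move=> [Q sQ EQ]; set a := c - th * dl in sQ.
have thd : 0 < th * dl by rewrite mulr_gt0.
have [BQ BQ0 BQP] := quasi_bound (proj1 sQ) EQ.
have {}BQP x : `|Q x| <= BQ by have := BQP x; rewrite mul0r subr0.
have [Bv BvP] := st_bdd S m01.
pose q1 x := Q x + (v (- X) - Q (- X)); pose q2 x := Q x + (v X - Q X).
have sq1 : sub H (fun=> a) setT q1 by exact: sub_addc.
have sq2 : sub H (fun=> a) setT q2 by exact: sub_addc.
have ca : c - dl <= a.
  have : th * dl <= 1 * dl by rewrite ler_pM2r.
  by rewrite /a; lra.
have sw : sub (pert H V) (fun=> a) setT (splice (- X) q1 (splice X v q2)).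
  apply: sub_splice.
  - rewrite /splice; case: leP => h; last lra.
    by rewrite /q1; lra.
  - apply: (@sub_le_eq _ H); first exact: sub_le sq1 _ _.
    by move=> z p [_ /= h]; rewrite /pert Vl // subr0.
  - apply: sub_splice; first by rewrite /q2; lra.
      by apply: sub_le sF _ _ => // z [[_ /= h1] /= h2]; apply/andP; split; lra.
    apply: (subH_right S) => [z [_ /= ?] //|].
    exact: sub_le sq2 _ _.
have := hmin a _ (BQ + `|v (- X) - Q (- X)| + `|v X - Q X| + Bv) sw.
have hh : c <= a -> False by rewrite /a; lra.
move=> h; apply: hh; apply: h => x; rewrite /splice.
have n1 := normr_ge0 (v (- X) - Q (- X)); have n2 := normr_ge0 (v X - Q X).
have n3 := BQP x; have n4 := BvP x; have n5 := normr_ge0 (v x).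
have n6 := ler_normD (Q x) (v (- X) - Q (- X)); have n7 := ler_normD (Q x) (v X - Q X).
rewrite -/v in n4.
by case: ifP => _; [rewrite /q1|case: ifP => _; rewrite ?/q2];
  clear - n1 n2 n3 n4 n5 n6 n7 BQ0; lra.
Qed.

(* Near [+oo], [w] can be lowered below the solutions without changing it at [x0]. *)
Definition lowerable F c (U : set_system R) (sol : R -> R -> R) w : Prop :=
  forall x0 e, 0 < e -> exists psi X', [/\ sub F (fun=> c) setT psi, w x0 <= psi x0 &
    \forall m \near U, forall x, X' <= x -> Num.min (w x) (psi x) <= sol m x + e].

(** [psi] follows [wb] up to [X] and then a subsolution drifting to [-oo], all raised by [k] to lie
    above [w] at [x0]. Beyond [X'] it is below [- C], hence below every solution. *)
Lemma lowerable_neg H V c X C sol A (U : set_system R) w : Filter U -> setup H V c X C sol ->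
  (\forall m \near U, 0 < m <= 1) -> has_drift H c A -> A < 0 -> lowerable (pert H V) c U sol w.
Proof.
move=> UF S U01 [P sP EP] A0 x0 e e0.
have [wb swb wbC] := st_wb S.
have [B B0 BP] := quasi_bound (proj1 sP) EP.
pose phi := splice X wb (fun x => P x + (wb X - P X)).
have sphi : sub (pert H V) (fun=> c) setT phi.
  apply: sub_splice; first lra.
    exact: sub_le swb _ _.
  apply: (subH_right S) => [z [_ /= ?] //|].
  by apply: sub_addc; exact: sub_le sP _ _.
pose k := `|w x0 - phi x0|.
pose kk := wb X - P X + k.
exists (fun x => phi x + k), (Num.max (X + 1) ((C + B + kk) / - A)); split.
- exact: sub_addc.
- by have := ler_norm (w x0 - phi x0); rewrite /k; lra.
apply: filterS U01 => m m01 x; rewrite ge_max => /andP[Xx Ax].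
have := st_lb S x m01; rewrite ge_min => Cu; apply/orP; right.
rewrite /phi /splice; case: (leP x X) => h; first lra.
move: Ax; rewrite ler_pdivrMr ?oppr_gt0 // => Ax.
by have := BP x; rewrite ler_norml => /andP[h1 h2]; rewrite /kk in Ax; lra.
Qed.

Lemma sub_line F g I q k : (forall s, I s -> F s q <= g s) -> sub F g I (fun x => q * x + k).
Proof.
move=> h; split=> [|y z yz yzI].
  by apply: contD; [apply: contM; [exact: cont_cst|exact: cont_id]|exact: cont_cst].
have yy : y <= y <= z by rewrite lexx ltW.
have -> : q * z + k - (q * y + k) = q * (z - y) by ring.
by split=> b hb; rewrite ler_pM2r ?subr_gt0 //; apply: (hb y) => //; apply: h; exact: yzI.
Qed.

(** Where [H y p0 < c], all slopes near [p0] are admissible near [y]. Replacing [P] on [[y, y + r]]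
    by lines of two different slopes gives two different increments over one period, hence two
    drifts. *)
Lemma rigid_ge H c : good H -> periodic1 H -> has_drift H c 0 -> (forall A, has_drift H c A -> A = 0) ->
  forall x p, c <= H x p.
Proof.
move=> gH pH [P sP EP] A0 y p0; rewrite leNgt; apply/negP => Hy.
pose e := (c - H y p0) / 2; have e0 : 0 < e by rewrite divr_gt0 // subr_gt0.
have [L L0 LP] := good_lip `|p0| gH; have L1 : 0 < L + 1 by lra.
have [d d0 dP] := good_unif gH (`|p0| + 1) e0.
pose rho := Num.min 1 (e / (L + 1)).
have rho0 : 0 < rho by rewrite lt_min ltr01 divr_gt0.
have rho1 : rho <= 1 by rewrite ge_min lexx.
have rhoL : rho * (L + 1) <= e by rewrite -ler_pdivlMr // ge_min lexx orbT.
pose r := Num.min (d / 2) 1.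
have r0 : 0 < r by rewrite lt_min ltr01 andbT divr_gt0.
have [rd r1] : r <= d / 2 /\ r <= 1 by rewrite !ge_min !lexx orbT.
have Hle s p : y <= s <= y + r -> `|p - p0| <= rho -> H s p <= c.
  move=> /andP[h1 h2] h3.
  have hp : `|p| <= `|p0| + 1.
    have := ler_normD p0 (p - p0); rewrite addrC subrK; lra.
  have hd : `|s - y| < d by rewrite ger0_norm; lra.
  have := dP s y p hp hd.
  have := LP y p p0 (lexx _) (le_trans h3 rho1).
  have : L * `|p - p0| <= L * rho by rewrite ler_wpM2l.
  by rewrite /e in rhoL *; lra.
have adm q : `|q - p0| <= rho -> P (y + 1) - (P (y + r) - q * r) = 0.
  move=> hq; pose l x := q * x + (P (y + r) - q * (y + r)).
  pose v := splice (y + r) l P.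
  have -> : P (y + 1) - (P (y + r) - q * r) = v (y + 1) - v y.
    rewrite /v /splice; case: leP => h1; case: leP => h2; rewrite /l; try lra.
    have E : y + 1 = y + r by lra.
    by rewrite E; lra.
  apply: A0; apply: drift_window => //.
  apply: sub_splice; first by rewrite /l; lra.
    apply: sub_line => s [/andP[h1 h2] /= h3]; apply: Hle => //.
    by rewrite h1.
  exact: sub_le sP _ _.
have h1 := adm (p0 + rho); rewrite addrC addKr gtr0_norm // lexx in h1.
have h2 := adm (p0 - rho); rewrite addrC addKr normrN gtr0_norm // lexx in h2.
have := h1 isT; have := h2 isT; have : 0 < rho * r by rewrite mulr_gt0.
lra.
Qed.

Lemma lowerable_rigid H V c X C sol (U : set_system R) w : ProperFilter U -> setup H V c X C sol ->
  (\forall m \near U, 0 < m <= 1) -> (forall A, has_drift H c A -> A = 0) ->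
  (forall x, sol m x @[m --> U] --> w x) -> sub (pert H V) (fun=> c) setT w ->
  lowerable (pert H V) c U sol w.
Proof.
move=> UF S U01 A0 uw sw x0 e e0.
have Hc := rigid_ge (st_H S) (st_per S) (st_drift0 S) A0.
(* A difference quotient of [wb] is a momentum with [c <= H <= c + V x + k]. The same argument with
   [sol m] where [V] vanishes gives [sol m x <= 0]. *)
have V0 x : 0 <= V x.
  apply/ler_addgt0Pr => k k0; have [wb swb _] := st_wb S.
  have cc : continuous (fun _ : R => c) by exact: cont_cst.
  have [r r0 rP] := sub_quot_near (x := x) (st_F S) swb cc filterT k0.
  have := rP x (x + r / 2); rewrite subrr normr0 (addrC x) addrK gtr0_norm ?divr_gt0 // => /(_ r0 _ _).
  have r2 : r / 2 < r by lra.
  move=> /(_ r2); rewrite ltrDr divr_gt0 // => /(_ isT).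
  by rewrite /pert; have := Hc x ((wb (r / 2 + x) - wb x) / (r / 2)); lra.
have u0 m x : 0 < m <= 1 -> X <= x -> sol m x <= 0.
  move=> m01 Xx; rewrite leNgt; apply/negP => ux.
  have [m0 m1] := andP m01; have sm := st_sub S m01.
  pose k := m * sol m x / 2; have k0 : 0 < k by rewrite divr_gt0 // mulr_gt0.
  have cg : continuous (fun x => c - m * sol m x).
    by apply: contB; [exact: cont_cst|apply: contM; [exact: cont_cst|exact: proj1 sm]].
  have [r r0 rP] := sub_quot_near (x := x) (st_F S) sm cg filterT k0.
  have := rP x (x + r / 2); rewrite subrr normr0 (addrC x) addrK gtr0_norm ?divr_gt0 // => /(_ r0 _ _).
  have r2 : r / 2 < r by lra.
  move=> /(_ r2); rewrite ltrDr divr_gt0 // => /(_ isT).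
  rewrite /pert (st_V S) // subr0.
  have := Hc x ((sol m (r / 2 + x) - sol m x) / (r / 2)); rewrite /k; rewrite /k in k0; lra.
have w0 x : X <= x -> w x <= 0.
  by move=> Xx; apply: (lim_le (uw x)); apply: filterS U01 => m m01; exact: u0.
have wC x : - C <= w x.
  by apply: (lim_ge (uw x)); apply: filterS U01 => m m01; exact: (st_lb S).
have [P1 sP1 EP1] := st_drift0 S.
have [t0 t0I t0P] := EVT_max (@ler01 R) (continuous_subspaceT (proj1 sP1)).
pose P x := P1 x - P1 t0.
have sP : sub H (fun=> c) setT P by exact: sub_addc.
have EP (k : int) x : P (x + k%:~R) = P x.
  have pP : periodic1 (fun x (_ : R) => P x) by move=> z _; rewrite /P EP1 addr0.
  by have /(congr1 (fun f => f x 0)) := @periodic1_int _ _ k pP.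
have P0 x : P x <= 0.
  rewrite -(EP (- Num.floor x)) mulrNz /P subr_le0; apply: t0P; rewrite in_itv /=.
  have h1 : (Num.floor x)%:~R <= x by exact: floor_le_tmp.
  have h2 : x < (Num.floor x)%:~R + 1 by have := floorD1_gt x; rewrite intrD.
  by apply/andP; split; lra.
have [BP BP0 BPP] := quasi_bound (proj1 sP1) EP1.
have PB x : - (2 * BP) <= P x.
  have := BPP x; have := BPP t0; rewrite !mul0r !subr0 !ler_norml /P => /andP[h1 h2] /andP[h3 h4].
  lra.
have sPF : sub (pert H V) (fun=> c) setT P.
  by apply: sub_le_eq sP _ => s p _; rewrite /pert gerBl.
have wP x : X + 1 <= x -> w x <= P x.
  move=> Xx; pose x1 := t0 + (Num.floor (x - t0))%:~R.
  have h1 : (Num.floor (x - t0))%:~R <= x - t0 by exact: floor_le_tmp.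
  have h2 : x - t0 < (Num.floor (x - t0))%:~R + 1 by have := floorD1_gt (x - t0); rewrite intrD.
  have Px1 : P x1 = 0 by rewrite /x1 EP /P subrr.
  have Px11 : P (x1 + 1) = 0 by rewrite -Px1 -(EP 1 x1).
  (* Following [w] from [x1] to [x] and then [P] up to [x1 + 1] has increment 0 by rigidity. As [P]
     vanishes at [x1] and [x1 + 1], this says [w x - P x = w x1], which is nonpositive. *)
  pose v := splice x w (fun z => P z + (w x - P x)).
  have : v (x1 + 1) - v x1 = 0.
    apply: A0; apply: drift_window; [exact: st_H S|exact: st_per S|].
    apply: sub_splice; first lra.
      apply: (subF_right S) => [s [/andP[h3 h4] _]|]; first by rewrite /x1 in h3; lra.
      exact: sub_le sw _ _.
    by apply: sub_addc; exact: sub_le sP _ _.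
  have w1 : w x1 <= 0 by apply: w0; rewrite /x1; lra.
  rewrite /v /splice; case: leP => h3; first by rewrite /x1 in h3; lra.
  by case: leP => h4; [rewrite Px11; lra|rewrite /x1 in h4; lra].
exists w, (X + 1); split=> //.
apply: filterS U01 => m m01 x Xx; rewrite minxx.
have [m0 m1] := andP m01.
(* A nonpositive critical subsolution is a discounted subsolution for every [m]. *)
pose v x := Num.min (w x) (P x).
have v0 z : v z <= 0 by rewrite /v ge_min P0 orbT.
have -> : w x = v x by rewrite /v; apply/esym/min_idPl; exact: wP.
suff : v x <= sol m x by lra.
apply: (@discounted_comparison _ (pert H V) m c (sol m) v (C + 2 * BP)) => //.
- exact: st_F S.
- exact: (st_sup S m01).
- by move=> z; have := st_lb S z m01; lra.
- apply: (@sub_le _ _ (fun=> c) _ setT) => //; first exact: sub_min.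
  move=> s _; have : 0 <= m * - v s by apply: mulr_ge0; [exact: ltW|rewrite oppr_ge0].
  by rewrite mulrN; lra.
move=> z; rewrite ler_norml; apply/andP; split.
  have C0 := setup_C0 S; rewrite /v le_min; apply/andP; split; first by have := wC z; lra.
  by have := PB z; lra.
by have := v0 z; have := setup_C0 S; lra.
Qed.

End RightEnd.

(** * The barrier *)

Section Barrier.
Set Implicit Arguments.
Unset Strict Implicit.
Context {R : realType}.
Implicit Types (F H : R -> R -> R) (V u v g w h : R -> R) (I : set R) (c X C m : R).

(* The competitor is a translate of [wF] left of [X]; from [Y] on it is
   [v1 = (1 - t) h + t chi], where [chi <= 0] makes the convex combination a
   discounted subsolution; between [X] and [Y] it is the minimum of [v1] and a
   subsolution of drift [A], still nonpositive there. *)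
Lemma barrier H c X C A e : good H -> has_drift H c 0 -> has_drift H c A -> 0 < A -> 0 <= C -> 0 < e ->
  exists X', forall F wF u h m, good F -> (forall s p, X <= s -> F s p = H s p) ->
    sub F (fun=> c) setT wF -> (forall x, `|wF x| <= C) -> 0 < m ->
    visc_supersol (discounted m F c) u -> (forall x, - C <= u x) ->
    sub H (fun x => c - m * h x) [set x | X <= x] h -> (forall x, X <= x -> `|h x| <= C) ->
    forall x, X' <= x -> h x <= u x + e.
Proof.
move=> gH [Q sQ EQ] [P sP EP] A0 C0 e0.
have [B1 B10 BP] := quasi_bound (proj1 sP) EP.
have [B3 B30 BQ] := quasi_bound (proj1 sQ) EQ.
pose C1 := B1 + 2 * B3.
have C10 : 0 <= C1 by rewrite addr_ge0 // mulr_ge0.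
pose Pp x := P x - P X.
have PpE x : A * (x - X) - 2 * C1 <= Pp x <= A * (x - X) + 2 * C1.
  have := BP x; have := BP X; rewrite !ler_norml => /andP[h1 h2] /andP[h3 h4].
  by rewrite /Pp /C1; apply/andP; split; lra.
have PpX : Pp X = 0 by rewrite /Pp subrr.
pose P0 x := Q x - B3.
have P00 x : - C1 <= P0 x <= 0.
  have := BQ x; rewrite mul0r subr0 ler_norml => /andP[h1 h2].
  by rewrite /P0 /C1; apply/andP; split; lra.
(* [T = t * N] is what [chi] takes off [v1]: enough for [v1 Y <= - 4 * C1 <= v2R Y]. The depth [B2]
   is such that conversely [v2R X = - B2 <= v1 X], so the minimum switches branches between [X] and
   [Y]. *)
pose T := C + 4 * C1 + 1; pose B2 := 2 * C + C1 + T.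
have B21 : 1 <= B2 by rewrite /B2 /T; lra.
have B2p : 0 < B2 := lt_le_trans ltr01 B21.
have E0 : 0 < C1 + 2 * C + 1 by lra.
(* [t * B2 <= 1] limits what [t * Pp] regains up to [Y]; the other bound limits the final loss
   [h - v1] to [e]. *)
pose t := Num.min B2^-1 (e / (C1 + 2 * C + 1)).
have t0 : 0 < t by rewrite lt_min invr_gt0 B2p divr_gt0.
have tB : t * B2 <= 1.
  have h : t <= B2^-1 by rewrite /t ge_min lexx.
  by have := ler_pM2r B2p t B2^-1; rewrite h mulVf ?gt_eqF.
have te : t * (C1 + 2 * C + 1) <= e by rewrite -ler_pdivlMr // ge_min lexx orbT.
have t1 : t <= 1.
  by have : t * 1 <= t * B2; [rewrite ler_pM2l|lra].
pose N := T / t.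
have tN : t * N = T by rewrite mulrC /N mulfVK // gt_eqF.
have N0 : 0 <= N by rewrite divr_ge0 // ?(ltW t0) // /T; lra.
(* Up to [Y] the function [Pp] stays below [B2], so [v2R] is nonpositive, and at [Y] it has risen to
   at least [B2 - 4 * C1]. *)
pose Y := X + (B2 - 2 * C1) / A.
have AY : A * (Y - X) = B2 - 2 * C1 by rewrite /Y addrC addKr mulrC mulfVK // gt_eqF.
have XY : X <= Y by rewrite lerDl divr_ge0 ?(ltW A0) // /B2 /T; lra.
(* From there on [N <= Pp x], so [chi] is at least [- (C1 + C)]. The threshold depends on none of
   [F], [wF], [u], [h], [m], so it serves all discounts and translates. *)
exists (Num.max (Y + 1) (X + (N + 2 * C1) / A)).
move=> F wF u h m gF FH swF wFC m0 su uC sh hC x; rewrite ge_max => /andP[Yx Xx].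
pose chi x := Num.min (Pp x - N) (P0 x - C).
have schi : sub H (fun=> c) setT chi by apply: sub_min; do 2?apply: sub_addc.
have chi0 y : chi y <= - C.
  by rewrite ge_min; have /andP[_ h1] := P00 y; apply/orP; right; clear - h1; lra.
have chil y : X <= y -> - (N + 2 * C1 + C) <= chi y.
  move=> Xy; rewrite le_min; have /andP[h1 _] := P00 y; have /andP[h2 _] := PpE y.
  have h3 : 0 <= A * (y - X) by rewrite mulr_ge0 ?(ltW A0) // subr_ge0.
  by clear - h1 h2 h3 N0 C10 C0; apply/andP; split; lra.
pose v1 y := t * chi y + (1 - t) * h y.
pose v2L y := wF y - wF X - B2.
pose v2R y := Pp y - B2.
pose v := splice X v2L (splice Y (fun y => Num.min (v1 y) (v2R y)) v1).
have hb y : X <= y -> - C <= h y <= C by move=> /hC; rewrite ler_norml.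
have v1X : - B2 <= v1 X.
  have h1 : - (t * N) - t * (C1 + C) <= t * chi X.
    rewrite -mulrN -mulrBr ler_pM2l // /chi PpX le_min; have /andP[h1 _] := P00 X.
    by clear - h1 N0 C10 C0; apply/andP; split; lra.
  have h2 : (1 - t) * - C <= (1 - t) * h X by apply: ler_wpM2l; [rewrite subr_ge0|case/andP: (hb X (lexx _))].
  have h3 : t * (C1 + C) <= 1 * (C1 + C) by apply: ler_wpM2r => //; rewrite addr_ge0.
  have h4 : (1 - t) * C <= 1 * C by apply: ler_wpM2r => //; rewrite gerBl ltW.
  by rewrite /v1; rewrite tN in h1; rewrite /B2; clear - h1 h2 h3 h4; lra.
have v1Y : v1 Y <= v2R Y.
  have /andP[p1 p2] := PpE Y; rewrite AY in p1 p2.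
  have h1 : t * chi Y <= t * (B2 - N) by rewrite ler_pM2l // ge_min; apply/orP; left; clear - p2; lra.
  have h2 : (1 - t) * h Y <= (1 - t) * C by apply: ler_wpM2l; [rewrite subr_ge0|case/andP: (hb Y XY)].
  have h4 : (1 - t) * C <= 1 * C by apply: ler_wpM2r => //; rewrite gerBl ltW.
  rewrite /v1 /v2R; rewrite mulrBr tN in h1; rewrite /T in h1; clear - h1 h2 h4 p1 tB; lra.
have v2R0 y : X <= y <= Y -> v2R y <= 0.
  move=> /andP[h1 h2]; have /andP[_ p2] := PpE y.
  have h3 : A * (y - X) <= A * (Y - X) by rewrite ler_pM2l // lerD2r.
  by rewrite /v2R; rewrite AY in h3; clear - h3 p2; lra.
have v2L0 y : v2L y <= 0.
  have := wFC y; have := wFC X; rewrite !ler_norml => /andP[h1 h2] /andP[h3 h4].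
  by rewrite /v2L /B2 /T; clear - h1 h2 h3 h4 C10 C0; lra.
have EX : v2L X = splice Y (fun y => Num.min (v1 y) (v2R y)) v1 X.
  rewrite /splice XY /v2L /v2R PpX subrr sub0r.
  by apply/esym/min_idPr.
have EY : Num.min (v1 Y) (v2R Y) = v1 Y by apply/min_idPl.
have sH g I w' : (forall s, I s -> X <= s) -> sub H g I w' -> sub F g I w'.
  by move=> IX /sub_le_eq; apply => s p /IX Xs; rewrite FH.
have ch := proj1 sh.
have sv1 : sub H (fun y => c - m * v1 y) [set y | X <= y] v1.
  have cg : continuous (fun y => c - m * h y).
    by apply: contB; [exact: cont_cst|apply: contM => //; exact: cont_cst].
  have := @sub_conv _ H (fun=> c) (fun y => c - m * h y) [set y | X <= y] chi h t gH
    (@cont_cst R R c) cg (sub_le schi (fun _ _ => I) (fun _ _ => lexx c)) sh.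
  rewrite (ltW t0) t1 => /(_ isT) hs.
  apply: sub_le hs _ _ => // y _.
  have h1 : 0 <= m * (t * - chi y).
    rewrite !mulr_ge0 ?(ltW m0) ?(ltW t0) // oppr_ge0.
    by apply: le_trans (chi0 y) _; rewrite oppr_le0.
  by rewrite /v1; clear - h1; lra.
have vR y : X < y -> v y = splice Y (fun y => Num.min (v1 y) (v2R y)) v1 y.
  by move=> h1; rewrite /v {1}/splice leNgt h1.
have vR' y : X <= y -> v y = splice Y (fun y => Num.min (v1 y) (v2R y)) v1 y.
  rewrite le_eqVlt => /orP[/eqP <-|]; last exact: vR.
  by rewrite /v {1}/splice lexx EX.
have sv : sub F (fun y => c - m * v y) setT v.
  apply: sub_splice => //.
    apply: (@sub_le _ _ (fun=> c) _ setT) => //; first by do 2!apply: sub_addc.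
    move=> s [_ /= sX]; rewrite /v /splice sX.
    have h1 : 0 <= m * - v2L s by apply: mulr_ge0; [exact: ltW|rewrite oppr_ge0].
    by clear - h1; lra.
  apply: sub_splice => //.
    apply: sub_min.
      apply: sH => [s [[_ h1] _] //|].
      apply: sub_le sv1 _ _ => [s [[_ h1] _] //|s [[_ /= h1] /= h2]].
      rewrite lerD2l lerN2 ler_pM2l // vR' // /splice h2 ge_min lexx //.
    apply: sH => [s [[_ h1] _] //|].
    apply: (@sub_le _ _ (fun=> c) _ setT) => //; first by do 2!apply: sub_addc.
    move=> s [[_ /= h1] /= h2]; rewrite vR' // /splice h2.
    have : Num.min (v1 s) (v2R s) <= 0.
      by rewrite ge_min v2R0 ?orbT // h1.
    rewrite -oppr_ge0 => h3.
    have h4 := mulr_ge0 (ltW m0) h3; clear - h4; lra.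
  apply: sH => [s [[_ h1] _] //|].
  apply: sub_le sv1 _ _ => [s [[_ h1] _] //|s [[_ /= h1] /= h2]].
  rewrite vR' // /splice; case: (leP s Y) => // h3.
  by have -> : s = Y by [apply/eqP; rewrite eq_le h3 h2]; rewrite EY.
have v1b y : X <= y -> - (N + 2 * C1 + 2 * C) <= v1 y <= C.
  move=> Xy; have := hb y Xy => /andP[h1 h2].
  have h3 : (1 - t) * - C <= (1 - t) * h y by apply: ler_wpM2l => //; rewrite subr_ge0.
  have h4 : (1 - t) * h y <= (1 - t) * C by apply: ler_wpM2l => //; rewrite subr_ge0.
  have h5 : 0 <= t * C by rewrite mulr_ge0 // ltW.
  have h6 : t * chi y <= t * - C by rewrite ler_pM2l.
  have h7 : t * - (N + 2 * C1 + C) <= t * chi y by rewrite ler_pM2l //; exact: chil.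
  have h8 : t * (N + 2 * C1 + C) <= 1 * (N + 2 * C1 + C) by apply: ler_wpM2r => //; rewrite !addr_ge0 // mulr_ge0.
  by rewrite /v1; clear - h3 h4 h5 h6 h7 h8; apply/andP; split; lra.
pose CC := N + 4 * C1 + 4 * C + B2.
have vCC y : `|v y| <= CC.
  have [Xy|Xy] := ltP X y.
    have /andP[b1 b2] := v1b y (ltW Xy); have /andP[p1 p2] := PpE y.
    have p3 : 0 <= A * (y - X) by rewrite mulr_ge0 ?(ltW A0) // subr_ge0 ltW.
    rewrite vR // /splice; case: (leP y Y) => h1; rewrite ler_norml /CC; last first.
      by clear - b1 b2 N0 C10 C0 B21; apply/andP; split; lra.
    rewrite le_min ge_min; apply/andP; split.
      by rewrite /v2R; clear - b1 p1 p3 N0 C10 C0 B21; apply/andP; split; lra.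
    by clear - b2 N0 C10 C0 B21; apply/orP; left; lra.
  rewrite /v /splice Xy ler_norml /CC.
  have := wFC y; have := wFC X; rewrite !ler_norml /v2L => /andP[h1 h2] /andP[h3 h4].
  by clear - h1 h2 h3 h4 N0 C10 C0 B21; apply/andP; split; lra.
have uCC y : - CC <= u y by have h1 := uC y; rewrite /CC; clear - h1 N0 C10 C0 B21; lra.
have vu := discounted_comparison gF m0 su uCC sv vCC x.
have Yx' : Y < x by clear - Yx; lra.
have xY : (x <= Y) = false by rewrite leNgt Yx'.
rewrite vR ?(le_lt_trans XY) // /splice xY /= in vu.
have NA : N <= Pp x.
  have /andP[p1 _] := PpE x.
  have h1 : (N + 2 * C1) / A <= x - X by clear - Xx; lra.
  by rewrite ler_pdivrMr // in h1; clear - h1 p1; lra.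
have Xx' : X <= x by rewrite (le_trans XY) // ltW.
have /andP[hx1 hx2] := hb x Xx'.
have chx : - (C1 + C) <= chi x.
  by have /andP[q1 q2] := P00 x; rewrite le_min; clear - q1 NA C10 C0; apply/andP; split; lra.
have h1 : t * - (C1 + C) <= t * chi x by rewrite ler_pM2l.
have h2 : t * h x <= t * C by rewrite ler_pM2l.
by rewrite /v1 in vu; clear - vu h1 h2 te t0; lra.
Qed.

Lemma good_shift F a : good F -> good (fun x p => F (x + a) p).
Proof.
move=> gF; split.
- by move=> x p q t; exact: (good_convex gF).
- by move=> M; have [K KP] := good_coercive gF M; exists K => x p; exact: KP.
- move=> K e e0; have [d d0 dP] := good_unif gF K e0; exists d => // x y p pK xy.
  by apply: dP => //; have -> : x + a - (y + a) = x - y by ring.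
- by move=> K; have [M MP] := good_bdd gF K; exists M => x p; exact: MP.
Qed.

Lemma is_C1_shift (phi : R -> R) (a : R) : is_C1 phi ->
  is_C1 (fun s => phi (s + a)) /\ forall x, (fun s => phi (s + a))^`() x = derive1 phi (x + a).
Proof.
move=> C; apply: is_C1_intro => [x|].
  have d := is_C1_is_derive (x + a) C.
  have e1 : is_derive x 1 (fun s : R => s + a) 1.
    have -> : (fun s : R => s + a) = (id + cst a) by apply/funext.
    by apply: is_derive_eq; rewrite addr0.
  by have := @is_derive1_comp _ phi (fun s => s + a) x _ _ d e1; rewrite mulr1.
apply: cont_comp; first exact: (proj2 C).
by apply: contD; [exact: cont_id|exact: cont_cst].
Qed.

Lemma supersol_shift F m c u a : visc_supersol (discounted m F c) u ->
  visc_supersol (discounted m (fun x p => F (x + a) p) c) (fun x => u (x + a)).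
Proof.
move=> [cu su]; split.
  by apply: cont_comp => //; apply: contD; [exact: cont_id|exact: cont_cst].
move=> phi x Cphi tch; have [C' E'] := is_C1_shift (- a) Cphi.
have := su _ (x + a) C'; rewrite E' addrK; apply.
case/nbhs_ballP: tch => d d0 dP; apply/nbhs_ballP; exists d => // y hy.
have hy' : ball x d (y - a).
  by move: hy; rewrite /ball /=; have -> : x - (y - a) = x + a - y by ring.
by have := dP _ hy'; rewrite /= subrK.
Qed.

(** The barrier compares [sol m] with its translates by [k >= 0] in both orders: beyond [X1] the
    solutions are periodic up to [e / 3], uniformly in [m]. Closeness of [sol m] and [w] on the
    single period [[X1, X1 + 1]] thus extends to the whole end, and [psi = w] will do. *)
Lemma lowerable_pos H V c X C sol A (U : set_system R) w : ProperFilter U -> setup H V c X C sol ->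
  (\forall m \near U, 0 < m <= 1) -> ~ (exists2 A, A < 0 & has_drift H c A) -> has_drift H c A -> 0 < A ->
  (forall x, sol m x @[m --> U] --> w x) -> sub (pert H V) (fun=> c) setT w ->
  lowerable (pert H V) c U sol w.
Proof.
move=> UF S U01 nneg admA A0 uw sw x0 e e0.
have [D DP] := upper_right S nneg.
have [K K0 KP] := setup_lip S.
have C0 := setup_C0 S.
have [wb swb wbC] := st_wb S.
pose C' := C + `|D|; have C'0 : 0 <= C' by rewrite addr_ge0.
have CC' : C <= C' by rewrite lerDl.
have e3 : 0 < e / 3 by rewrite divr_gt0.
have [X1 X1P] := barrier X (st_H S) (st_drift0 S) admA A0 C'0 e3.
have lb m x : 0 < m <= 1 -> - C' <= sol m x.
  by move=> m01; apply: le_trans (st_lb S x m01); rewrite lerN2.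
have ub m x : 0 < m <= 1 -> X <= x -> `|sol m x| <= C'.
  move=> m01 Xx; rewrite ler_norml lb //=; have := DP m x m01 Xx.
  by have := ler_norm D; rewrite /C'; lra.
have wbC' x : `|wb x| <= C' by apply: le_trans (wbC x) _.
have k0 (k : int) : 0 <= k -> (0 : R) <= k%:~R by rewrite ler0z.
have sR m : 0 < m <= 1 -> sub H (fun x => c - m * sol m x) [set x | X <= x] (sol m).
  move=> m01; apply: (subF_right S) => //.
  exact: sub_le (st_sub S m01) _ _.
have beta m (k : int) x : 0 < m <= 1 -> 0 <= k -> X1 <= x ->
    sol m (x + k%:~R) <= sol m x + e / 3.
  move=> m01 /k0 kk; move: x; have [m0 m1] := andP m01.
  apply: (X1P (pert H V) wb (sol m) (fun x => sol m (x + k%:~R)) m) => //.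
  - exact: st_F S.
  - by move=> s p Xs; rewrite /pert (st_V S) ?subr0.
  - exact: (st_sup S m01).
  - by move=> x; exact: lb.
  - have := sub_shift k%:~R (sR m m01); rewrite (periodic1_int _ (st_per S)).
    by move/sub_le; apply => // s /= Xs; lra.
  - by move=> x Xx; apply: ub => //; lra.
have alpha m (k : int) x : 0 < m <= 1 -> 0 <= k -> X1 <= x ->
    sol m x <= sol m (x + k%:~R) + e / 3.
  move=> m01 /k0 kk; move: x; have [m0 m1] := andP m01.
  apply: (X1P (fun x p => pert H V (x + k%:~R) p) (fun x => wb (x + k%:~R))
    (fun x => sol m (x + k%:~R)) (sol m) m) => //.
  - exact: (good_shift _ (st_F S)).
  - move=> s p Xs; rewrite /pert (st_V S) ?subr0; last by lra.
    by have /(congr1 (fun f => f s p)) := periodic1_int k (st_per S).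
  - exact: (sub_shift k%:~R swb).
  - exact: (supersol_shift _ (st_sup S m01)).
  - by move=> x; exact: lb.
  - by apply: sR.
  - by move=> x Xx; exact: ub.
have wbeta (k : int) x : 0 <= k -> X1 <= x -> w (x + k%:~R) <= w x + e / 3.
  move=> kk Xx; rewrite -lerBlDl.
  have lm : sol m (x + k%:~R) - sol m x @[m --> U] --> w (x + k%:~R) - w x.
    by apply: (@cvgB _ _ _ U _ (sol ^~ (x + k%:~R)) (sol ^~ x)).
  apply: (lim_le lm); apply: filterS U01 => m m01; rewrite lerBlDl; exact: beta.
exists w, X1; split=> //.
apply: filterS2 U01 (@loc_unif _ U sol w K X1 (X1 + 1) _ UF K0 U01 KP uw e3) => m m01 unif x Xx.
rewrite minxx; pose k := Num.floor (x - X1); pose x' := x - k%:~R.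
have h1 : k%:~R <= x - X1 by exact: floor_le_tmp.
have h2 : x - X1 < k%:~R + 1 by have := floorD1_gt (x - X1); rewrite intrD.
have kk : 0 <= k by rewrite floor_ge_int_tmp // subr_ge0.
have Xx' : X1 <= x' by rewrite /x'; lra.
have xE : x = x' + k%:~R by rewrite /x' subrK.
have a1 := wbeta k x' kk Xx'; have a2 := alpha m k x' m01 kk Xx'.
rewrite -xE in a1 a2.
have := unif x'; rewrite Xx' /= => /(_ _)/(le_trans (ler_norm _)) a3.
have : w x' - sol m x' <= e / 3 by apply: a3; rewrite /x'; lra.
lra.
Qed.

Lemma lowerable_right H V c X C sol (U : set_system R) w : ProperFilter U -> setup H V c X C sol ->
  (\forall m \near U, 0 < m <= 1) ->
  (forall x, sol m x @[m --> U] --> w x) -> sub (pert H V) (fun=> c) setT w ->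
  lowerable (pert H V) c U sol w.
Proof.
move=> UF S U01 uw sw.
have [[A A0 admA]|nneg] := pselect (exists2 A, A < 0 & has_drift H c A).
  exact: (lowerable_neg w _ S U01 admA A0).
have [[A A0 admA]|npos] := pselect (exists2 A, 0 < A & has_drift H c A).
  exact: (lowerable_pos UF S U01 nneg admA A0 uw sw).
apply: (lowerable_rigid UF S U01 _ uw sw) => A admA.
apply/eqP; rewrite eq_le !leNgt; apply/andP; split; apply/negP => h.
  by apply: npos; exists A.
by apply: nneg; exists A.
Qed.

End Barrier.

(** * Convergence *)

Section Convergence.
Set Implicit Arguments.
Unset Strict Implicit.
Context {R : realType}.
Implicit Types (F H : R -> R -> R) (V u v g w h : R -> R) (I : set R) (c X C m : R).

Lemma setup_mirror H V c X C sol : setup H V c X C sol -> (forall x, x <= - X -> V x = 0) ->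
  setup (mirr H) (fun x => V (- x)) c X C (fun m x => sol m (- x)).
Proof.
move=> S Vl; split.
- exact: good_mirr (st_H S).
- exact: periodic1_mirr (st_per S).
- exact: good_mirr (st_F S).
- by move=> x Xx; apply: Vl; rewrite lerN2.
- by have := drift_mirr (st_drift0 S); rewrite oppr0.
- have [wb sw wC] := st_wb S; exists (fun x => wb (- x)) => //.
  exact: sub_le (sub_mirror sw) _ _.
- move=> m m01; exact: sub_le (sub_mirror (st_sub S m01)) _ _.
- move=> m m01; exact: supersol_mirror (st_sup S m01).
- by move=> m m01; have [B BP] := st_bdd S m01; exists B.
- by move=> m x m01; exact: (st_lb S).
Qed.

Lemma crit_drift_le H V X c v B : good H -> periodic1 H -> (forall x, X <= x -> V x = 0) ->
  forall e, 0 < e -> sub (pert H V) (fun=> c + e) setT v -> (forall x, `|v x| <= B) ->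
  exists2 A, A <= e & has_drift H (c + e) A.
Proof.
move=> gH pH VX e e0 sv vB.
apply: (@window_rise _ H (c + e) X v (2 * B) e) => //.
  apply: (@sub_le_eq _ (pert H V)); first exact: sub_le sv _ _.
  by move=> s p /= Xs; rewrite /pert VX // subr0.
move=> x _; have := vB x; have := vB X; rewrite !ler_norml => /andP[? ?] /andP[? ?]; lra.
Qed.

(** A bounded subsolution near the critical level has drifts at most [e] at the right end and, by
    reflection, at least [- e] at the left end; since drifts form an interval, one of them is within
    [e] of 0. *)
Lemma crit_drift0 H V X c : good H -> periodic1 H ->
  (forall x, X <= x -> V x = 0) -> (forall x, x <= - X -> V x = 0) ->
  (forall e, 0 < e -> exists v B, sub (pert H V) (fun=> c + e) setT v /\
     forall x, `|v x| <= B) -> has_drift H c 0.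
Proof.
move=> gH pH VX VXl hc; apply: drift_lim0 => // e e0.
have [v [B [sv vB]]] := hc e e0.
have [A1 A1e adm1] := crit_drift_le gH pH VX e0 sv vB.
have sv' : sub (pert (mirr H) (fun x => V (- x))) (fun=> c + e) setT (fun x => v (- x)).
  exact: sub_le (sub_mirror sv) _ _.
have VXl' x : X <= x -> V (- x) = 0 by move=> Xx; apply: VXl; rewrite lerN2.
have [A2 A2e adm2] := crit_drift_le (good_mirr gH) (periodic1_mirr pH) VXl' e0 sv'
  (fun x => vB (- x)).
have {}adm2 : has_drift H (c + e) (- A2) by have := drift_mirr adm2; rewrite mirrK.
have [h1|h1] := leP (- e) A1.
  by exists A1 => //; rewrite ler_norml h1.
have [h2|h2] := leP (- A2) e.
  by exists (- A2) => //; rewrite ler_norml h2 andbT lerN2.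
exists 0; first by rewrite normr0 ltW.
by apply: (drift_between gH adm1 adm2); apply/andP; split; lra.
Qed.

(** The limit [W] of nearly critical subsolutions may be unbounded. Only its part on [[- X, X]] is
    kept, continued on both sides by the periodic [Q]. *)
Lemma crit_wb H V X c : good H -> good (pert H V) -> 0 <= X -> has_drift H c 0 ->
  (forall x, X <= x -> V x = 0) -> (forall x, x <= - X -> V x = 0) ->
  (forall e, 0 < e -> exists v B, sub (pert H V) (fun=> c + e) setT v /\
     forall x, `|v x| <= B) ->
  exists wb B, sub (pert H V) (fun=> c) setT wb /\ forall x, `|wb x| <= B.
Proof.
move=> gH gF X0 [Q sQ EQ] VX VXl hc.
have /choice[f fP] : forall e, exists v : R -> R, 0 < e ->
    sub (pert H V) (fun=> c + e) setT v /\ v 0 = 0.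
  move=> e; have [e0|] := ltP 0 e; last by exists (fun=> 0).
  have [v [B [sv _]]] := hc e e0; exists (fun x => v x - v 0) => _.
  by split; [exact: sub_addc|rewrite subrr].
have [_ [_ _ [W sW _]]] := level_limit gF fP.
have [BQ BQ0 BQP] := quasi_bound (proj1 sQ) EQ.
have {}BQP x : `|Q x| <= BQ by have := BQP x; rewrite mul0r subr0.
have XX : - X <= X by lra.
have [a _ aP] := EVT_max XX (continuous_subspaceT (proj1 sW)).
have [b _ bP] := EVT_min XX (continuous_subspaceT (proj1 sW)).
pose k1 := W (- X) - Q (- X); pose k2 := W X - Q X.
exists (splice (- X) (fun x => Q x + k1) (splice X W (fun x => Q x + k2))).
exists (BQ + `|k1| + `|k2| + `|W a| + `|W b|); split.
  apply: sub_splice.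
  - by rewrite /splice XX /k1; lra.
  - apply: (@sub_le_eq _ H); first by apply: sub_addc; exact: sub_le sQ _ _.
    by move=> s p [_ /= h]; rewrite /pert VXl // subr0.
  - apply: sub_splice; first by rewrite /k2; lra.
      exact: sub_le sW _ _.
    apply: (@sub_le_eq _ H); first by apply: sub_addc; exact: sub_le sQ _ _.
    by move=> s p [_ /= h]; rewrite /pert VX // subr0.
move=> x; have n1 := normr_ge0 k1; have n2 := normr_ge0 k2.
have n3 := normr_ge0 (W a); have n4 := normr_ge0 (W b); have n5 := BQP x.
have n6 := ler_normD (Q x) k1; have n7 := ler_normD (Q x) k2.
rewrite /splice; have [h|h] := leP x (- X); first by clear - n1 n2 n3 n4 n5 n6 n7; lra.
have [h'|h'] := leP x X; last by clear - n1 n2 n3 n4 n5 n6 n7; lra.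
have xI : x \in `[- X, X]%R by rewrite in_itv /= h' ltW.
have h1 := aP x xI; have h2 := bP x xI.
have h3 := ler_norm (W a); have h4 := ler_norm (- W b); rewrite normrN in h4.
by rewrite ler_norml; apply/andP; split; clear - h1 h2 h3 h4 n1 n2 n3 n4 BQ0; lra.
Qed.

(** [wb - B] is nonpositive, hence a discounted subsolution for every [m]. *)
Lemma solution_lower_bound F c m u wb B : good F -> 0 < m -> visc_supersol (discounted m F c) u ->
  (exists D, forall x, `|u x| <= D) -> sub F (fun=> c) setT wb -> (forall x, `|wb x| <= B) ->
  forall x, - (2 * B) <= u x.
Proof.
move=> gF m0 su [D DP] swb wbB x.
have B0 := le_trans (normr_ge0 _) (wbB 0); have D0 := le_trans (normr_ge0 _) (DP 0).
have wB y : - B <= wb y <= B by rewrite -ler_norml.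
suff : wb x - B <= u x by have /andP[? _] := wB x; lra.
apply: (@discounted_comparison _ F m c u (fun y => wb y - B) (2 * B + D)) => //.
- by move=> y; have := DP y; rewrite ler_norml => /andP[? _]; lra.
- apply: (@sub_le _ _ (fun=> c) _ setT) => //; first exact: sub_addc.
  move=> y _; have /andP[_ h] := wB y.
  have : 0 <= m * (B - wb y) by apply: mulr_ge0; [exact: ltW|rewrite subr_ge0].
  lra.
- by move=> y; have /andP[? ?] := wB y; rewrite ler_norml; apply/andP; split; lra.
Qed.

(** The mixture [v] has level [c - t * m * sol m = c - lam * sol m], which is at most [c - lam * v]
    because [w <= sol m] gives [v <= sol m]. *)
Lemma discount_mix H V c X C sol w B m lam : setup H V c X C sol ->
  sub (pert H V) (fun=> c) setT w -> (forall x, `|w x| <= B) -> 0 < m <= 1 ->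
  (forall x, w x <= sol m x) -> 0 < lam <= m ->
  forall x, (1 - lam / m) * w x + lam / m * sol m x <= sol lam x.
Proof.
move=> S sw wB m01 wm /andP[l0 lm]; have [m0 m1] := andP m01.
have l01 : 0 < lam <= 1 by rewrite l0 (le_trans lm).
pose t := lam / m; have tm : t * m = lam by rewrite /t mulfVK // gt_eqF.
have t0 : 0 <= t by rewrite /t divr_ge0 // ltW.
have t1 : t <= 1 by rewrite /t ler_pdivrMr // mul1r.
have sm := st_sub S m01; have [Bm BmP] := st_bdd S m01; have [Bl BlP] := st_bdd S l01.
have B0 := le_trans (normr_ge0 _) (wB 0).
have Bm0 := le_trans (normr_ge0 _) (BmP 0); have Bl0 := le_trans (normr_ge0 _) (BlP 0).
pose v x := t * sol m x + (1 - t) * w x.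
move=> x; rewrite addrC -/t -/(v x).
apply: (@discounted_comparison _ (pert H V) lam c (sol lam) v (B + Bm + Bl)) => //.
- exact: st_F S.
- exact: (st_sup S l01).
- by move=> y; have := BlP y; rewrite ler_norml => /andP[h _]; clear - h B0 Bm0; lra.
- have cg : continuous (fun y => c - m * sol m y).
    by apply: contB; [exact: cont_cst|apply: contM; [exact: cont_cst|exact: proj1 sm]].
  have := sub_conv (t := t) (st_F S) cg (@cont_cst R R c) sm sw.
  rewrite t0 t1 => /(_ isT)/sub_le; apply => // y _.
  have h1 : 0 <= (1 - t) * (sol m y - w y) by apply: mulr_ge0; rewrite subr_ge0.
  have h2 : 0 <= lam * ((1 - t) * (sol m y - w y)) by apply: mulr_ge0 => //; exact: ltW.
  by rewrite -tm in h2 *; rewrite /v; clear - h2; lra.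
move=> y; rewrite /v; apply: le_trans (ler_normD _ _) _.
rewrite (normrM t) (normrM (1 - t)) (ger0_norm t0) (@ger0_norm _ (1 - t)) ?subr_ge0 //.
have h1 : t * `|sol m y| <= 1 * Bm by apply: ler_pM.
have h2 : (1 - t) * `|w y| <= 1 * B by apply: ler_pM => //; [rewrite subr_ge0|rewrite gerBl].
by clear - h1 h2 Bl0; lra.
Qed.

Lemma sub_below_limit H V c X C sol w (z : R) B m (U : set_system R) x : ProperFilter U ->
  0^'+ `<=` U -> setup H V c X C sol -> sub (pert H V) (fun=> c) setT w ->
  (forall x, `|w x| <= B) -> 0 < m <= 1 -> (forall x, w x <= sol m x) ->
  sol l x @[l --> U] --> z -> w x <= z.
Proof.
move=> UF sU S sw wB m01 wm lw; have [m0 m1] := andP m01.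
apply/ler_addgt0Pr => e e0; rewrite -lerBlDr.
apply: (lim_ge lw); apply: sU.
pose D := `|sol m x - w x| + 1.
have D0 : 0 < D by rewrite ltr_wpDl.
near=> l.
have l0 : 0 < l by near: l; exact: nbhs_right_gt.
have lm : l <= m by near: l; exact: nbhs_right_le.
have le : l <= e * m / D by near: l; apply: nbhs_right_le; rewrite divr_gt0 // mulr_gt0.
have := discount_mix S sw wB m01 wm (lam := l); rewrite l0 lm => /(_ isT x).
pose t := l / m; rewrite -/t.
have t0 : 0 <= t by rewrite divr_ge0 // ltW.
have tD : t * D <= e.
  rewrite ler_pdivlMr // in le.
  by rewrite /t mulrAC ler_pdivrMr.
have h := ler_norm (- (sol m x - w x)); rewrite normrN in h.
have h2 : t * - (sol m x - w x) <= t * D by apply: ler_wpM2l => //; rewrite /D; clear - h; lra.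
by move=> h3; clear - h3 h2 tD; lra.
Unshelve. all: by end_near. Qed.

Lemma limits_le H V c X C sol (U U' : set_system R) w w' : ProperFilter U -> ProperFilter U' ->
  0^'+ `<=` U -> 0^'+ `<=` U' -> setup H V c X C sol -> (forall x, x <= - X -> V x = 0) ->
  (forall x, sol m x @[m --> U] --> w x) -> (forall x, sol m x @[m --> U'] --> w' x) ->
  sub (pert H V) (fun=> c) setT w -> forall x, w x <= w' x.
Proof.
move=> UF UF' sU sU' S Vl lw lw' sw x0.
have U01 : \forall m \near U, 0 < m <= 1.
  apply: sU; near=> m; apply/andP; split; near: m; first exact: nbhs_right_gt.
  exact: nbhs_right_le.
have S' := setup_mirror S Vl.
have sw' : sub (pert (mirr H) (fun x => V (- x))) (fun=> c) setT (fun x => w (- x)).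
  exact: sub_le (sub_mirror sw) _ _.
have R1 := lowerable_right UF S U01 lw sw.
have R2 := lowerable_right UF S' U01 (fun x => lw (- x)) sw'.
apply/ler_addgt0Pr => e e0.
have [psi [X1 [spsi px n1]]] := R1 x0 e e0.
have [psi' [X2 [spsi' px' n2]]] := R2 (- x0) e e0.
have {}spsi' : sub (pert H V) (fun=> c) setT (fun x => psi' (- x)) by exact: sub_mirrorT.
have [K K0 KP] := setup_lip S.
have n3 := @loc_unif _ U sol w K (- X2) X1 _ UF K0 U01 KP lw e0.
have [wb swb wbC] := st_wb S; have C0 := setup_C0 S.
pose W x := Num.min (Num.min (w x) (psi x)) (psi' (- x)).
have sW : sub (pert H V) (fun=> c) setT W := sub_min (sub_min sw spsi) spsi'.
(* The ends are controlled by lowering, the middle by local uniform convergence along [U]; a single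
   [m] is then fixed. *)
have [m [m01 Wm]] : exists m, 0 < m <= 1 /\ forall x, W x <= sol m x + e.
  apply: (@filter_ex _ U); apply: filterS2 (filterI n1 n2) (filterI n3 U01).
  move=> m [h1 h2] [h3 m01]; split=> // x.
  have [Xx|xX] := leP X1 x; first by apply: le_trans (h1 x Xx); rewrite /W ge_min lexx.
  have [Xx|xX'] := leP X2 (- x).
    have := h2 (- x) Xx; rewrite opprK; apply: le_trans.
    by rewrite /W le_min !ge_min !lexx ?orbT.
  have : `|w x - sol m x| <= e by apply: h3; apply/andP; split; [rewrite lerNl|]; exact: ltW.
  move/(le_trans (ler_norm _)) => h4; rewrite /W !ge_min; apply/orP; left; apply/orP; left; lra.
(* Lowering may destroy the lower bound needed for comparison. The function [wb - 2 * C], which lies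
   below [- C] and so below [sol m], restores it. *)
pose w1 x := Num.max (W x - e) (wb x - 2 * C).
have sw1 : sub (pert H V) (fun=> c) setT w1 by apply: sub_max; exact: sub_addc.
have wbb x : - C <= wb x <= C by rewrite -ler_norml.
have w1m x : w1 x <= sol m x.
  rewrite /w1 ge_max; apply/andP; split; first by have := Wm x; lra.
  by have := st_lb S x m01; have /andP[_ h] := wbb x; clear - h C0; lra.
have [B BP] := st_bdd S m01.
have B0 := le_trans (normr_ge0 _) (BP 0).
have w1B x : `|w1 x| <= B + 3 * C.
  rewrite ler_norml; apply/andP; split.
    by rewrite /w1 le_max; have /andP[h _] := wbb x; apply/orP; right; clear - h B0; lra.
  by have := w1m x; have := BP x; rewrite ler_norml => /andP[_ h1] h2; clear - h1 h2 C0; lra.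
have h1 := sub_below_limit UF' sU' S sw1 w1B m01 w1m (lw' x0).
rewrite opprK in px'.
have h2 : W x0 = w x0 by rewrite /W !min_l.
have h3 : W x0 - e <= w1 x0 by rewrite /w1 le_max lexx.
lra.
Unshelve. all: by end_near. Qed.

Lemma loc_bounded H V c X C sol : setup H V c X C sol -> 0 <= X ->
  (forall x, x <= - X -> V x = 0) ->
  (forall a v B, sub (pert H V) (fun=> a) setT v -> (forall x, `|v x| <= B) -> c <= a) ->
  exists B : R -> R, forall m x, 0 < m <= 1 -> `|sol m x| <= B x.
Proof.
move=> S X0 Vl hmin; have [K K0 KP] := setup_lip S; have C0 := setup_C0 S.
suff [D [Y DY]] : exists D Y, 0 <= Y /\ forall m, 0 < m <= 1 ->
    exists2 y, `|y| <= Y & sol m y <= D.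
  have [Y0 {}DY] := DY.
  exists (fun x => C + `|D| + K * (`|x| + Y)) => m x m01.
  have [y yY yD] := DY m m01.
  have := KP m y x m01; rewrite ler_norml => /andP[_ h1].
  have h2 : K * `|x - y| <= K * (`|x| + Y).
    by rewrite ler_pM2l //; apply: le_trans (ler_normB _ _) _; rewrite lerD2l.
  have h3 : 0 <= K * (`|x| + Y) by rewrite mulr_ge0 ?(ltW K0) // addr_ge0.
  have h4 := st_lb S x m01; have h5 := ler_norm D; have h6 := normr_ge0 D.
  by rewrite ler_norml; apply/andP; split; clear - h1 h2 h3 h4 h5 h6 yD C0; lra.
have [[A1 A10 adm1]|nneg] := pselect (exists2 A, A < 0 & has_drift H c A); last first.
  have [D DP] := upper_right S nneg; exists D, X; split=> // m m01.
  by exists X; [rewrite ger0_norm|exact: DP].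
have [[A2 A20 adm2]|npos] := pselect (exists2 A, 0 < A & has_drift H c A); last first.
  have [|D DP] := upper_right (setup_mirror S Vl).
    move=> [A A0 admA]; apply: npos; exists (- A); first by rewrite oppr_gt0.
    by have := drift_mirr admA; rewrite mirrK.
  exists D, X; split=> // m m01; exists (- X); first by rewrite normrN ger0_norm.
  exact: DP.
exists 0, (X + 1); split=> [|m m01]; first lra.
have [y /andP[y1 y2] y0] := upper_mid S X0 Vl hmin adm1 A10 adm2 A20 m01.
by exists y => //; rewrite ler_norml; apply/andP; split; lra.
Qed.

Lemma supersol_limit F c (U : set_system R) (sol : R -> R -> R) w K : good F -> ProperFilter U -> 0 < K ->
  0^'+ `<=` U -> (forall m, 0 < m <= 1 -> visc_supersol (discounted m F c) (sol m)) ->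
  (forall m y z, 0 < m <= 1 -> `|sol m z - sol m y| <= K * `|z - y|) ->
  (forall x, sol m x @[m --> U] --> w x) -> continuous w ->
  visc_supersol (stationary F c) w.
Proof.
move=> gF UF K0 sU su KP lw cw; split=> // phi x Cphi /nbhs_ballP[r /= r0 rP].
rewrite /stationary subr_ge0 leNgt; apply/negP => Fc.
set d := phi^`() x in Fc.
(* Three errors of size [e] must stay below the gap: the discount term, the move from [y] to [x],
   and the change of slope from [q] to [d]. *)
pose e := (c - F x d) / 4; have e0 : 0 < e by rewrite divr_gt0 // subr_gt0.
have [L L0 LP] := good_lip `|d| gF.
have [d1 d10 d1P] := good_unif gF (`|d| + 1) e0.
have L1 : 0 < L + 1 by rewrite ltr_wpDl.
pose k := Num.min 1 (e / (L + 1)); have k0 : 0 < k by rewrite lt_min ltr01 divr_gt0.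
have k1 : k <= 1 by rewrite ge_min lexx.
have kL : L * k <= e.
  have h : k * (L + 1) <= e by rewrite -ler_pdivlMr // ge_min lexx orbT.
  by clear - h k0; lra.
have k20 : 0 < k / 2 by rewrite divr_gt0.
have /continuous_distP/(_ x _ k20)[d2 d20 d2P] := proj2 Cphi.
(* The four bounds keep [y] in the touching neighbourhood, control the variation of [F] in [x] and
   of [phi'], and make the slope [2 * s] of the quadratic term at most [k / 2]. *)
pose s := Num.min (Num.min (r / 2) (d1 / 2)) (Num.min (d2 / 2) (k / 4)).
have s0 : 0 < s by rewrite !lt_min !divr_gt0.
have [sr sd1 sd2 sk] : [/\ s <= r / 2, s <= d1 / 2, s <= d2 / 2 & s <= k / 4].
  by split; rewrite /s !ge_min lexx ?orbT.
have rb y : `|x - y| <= s -> w x - phi x <= w y - phi y.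
  by move=> h; apply: rP; rewrite /ball /=; clear - h sr r0; lra.
(* With this accuracy the perturbed minimum satisfies [(y - x) ^+ 2 <= s ^+ 2 / 2], so it is
   interior. *)
have s20 : 0 < s ^+ 2 / 4 by rewrite divr_gt0 // exprn_gt0.
have U01 : \forall m \near U, 0 < m <= 1.
  apply: sU; near=> m; apply/andP; split; near: m; first exact: nbhs_right_gt.
  exact: nbhs_right_le.
have unif := @loc_unif _ U sol w K (x - s) (x + s) _ UF K0 U01 KP lw s20.
pose M := `|w x| + K * s + s ^+ 2 + 1.
have M0 : 0 < M by rewrite /M; have := normr_ge0 (w x); have : 0 < K * s by [rewrite mulr_gt0]; clear - s20; lra.
have Usmall : \forall m \near U, m <= e / M.
  by apply: sU; apply: nbhs_right_le; rewrite divr_gt0.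
have [m [[m01 mun] mM]] := filter_ex (filterI (filterI U01 unif) Usmall).
have [m0 m1] := andP m01.
have [Cq Eq] := is_C1_quad (- 1) 0 x.
have [Cp Ep] := is_C1_add Cphi Cq.
pose ps y := phi y + (- 1 * (y - x) ^+ 2 + 0 * y ^+ 2).
have cphi : continuous phi.
  by move=> y; apply/differentiable_continuous/derivable1_diffP; exact: (proj1 Cphi).
have cps : continuous ps.
  by move=> y; apply/differentiable_continuous/derivable1_diffP; exact: (proj1 Cp).
have cf : continuous (fun y => sol m y - ps y) by apply: contB => //; exact: proj1 (su m m01).
have xs : x - s <= x + s by clear - s0; lra.
have [y yI ymin] := EVT_min xs (continuous_subspaceT cf).
rewrite in_itv /= in yI; have [y1 y2] := andP yI.
have xI : x \in `[x - s, x + s]%R by rewrite in_itv /=; apply/andP; split; clear - s0; lra.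
have hx := ymin x xI; rewrite /ps subrr in hx.
have xI' : x - s <= x <= x + s by rewrite in_itv in xI.
have := mun x xI'; have := mun y yI; rewrite !ler_norml => /andP[a1 a2] /andP[a3 a4].
have yx : `|x - y| <= s by rewrite ler_norml; apply/andP; split; clear - y1 y2; lra.
have b1 := rb y yx.
have ysq : (y - x) ^+ 2 <= s ^+ 2 / 2.
  by rewrite expr0n /= in hx; clear - hx a1 a2 a3 a4 b1; lra.
have yin : `|y - x| < s.
  rewrite ltNge; apply/negP => h.
  have h2 : s ^+ 2 <= (y - x) ^+ 2.
    by rewrite -(real_normK (num_real (y - x))) lerXn2r ?nnegrE // ltW.
  by clear - h2 ysq s20; lra.
have yin' : x - s < y < x + s by rewrite -ltr_distl.
have near_y : \forall z \near y, sol m y - ps y <= sol m z - ps z.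
  by apply: filterS (near_itv yin') => z /andP[z1 z2]; apply: ymin; rewrite in_itv /= !ltW.
have := (proj2 (su m m01)) ps y Cp near_y.
rewrite Ep Eq /discounted; set q := derive1 phi y + _ => hq.
have qd : `|q - d| <= k.
  have h1 : `|d - derive1 phi y| < k / 2 by apply: d2P; clear - yx sd2 d20; lra.
  move: h1 yin; rewrite !ltr_norml /q => /andP[h1 h2] /andP[h3 h4].
  by rewrite ler_norml; apply/andP; split; clear - h1 h2 h3 h4 sk; lra.
have qK : `|q| <= `|d| + 1.
  have := ler_normD d (q - d); rewrite addrC subrK => h; clear - h qd k1; lra.
have F1 := d1P y x q qK; have h1 : `|y - x| < d1 by clear - yin sd1 d10; lra.
have {}F1 := F1 h1.
have F2 := LP x q d (lexx _) (le_trans qd k1).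
have F3 : L * `|q - d| <= L * k by rewrite ler_wpM2l.
have ms : m * sol m y <= e.
  have h : sol m y <= M.
    have := KP m x y m01; rewrite ler_norml => /andP[_ h].
    have h2 : K * `|y - x| <= K * s by rewrite ler_pM2l // ltW.
    have h3 := ler_norm (w x).
    by rewrite /M; clear - h h2 h3 a3 s20; lra.
  have h2 : m * sol m y <= m * M by rewrite ler_pM2l.
  by rewrite ler_pdivlMr // in mM; clear - h2 mM; lra.
by rewrite /e in F1 ms kL; clear - hq F1 F2 F3 ms kL Fc; lra.
Unshelve. all: by end_near. Qed.

(** If a neighbourhood of [l] were missed frequently, an ultrafilter finer than [0^'+] would contain
    the set where it is missed. *)
Lemma cvg_of_ultra (f : R -> R) (l : R) : (forall U : set_system R, UltraFilter U -> 0^'+ `<=` U ->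
  f m @[m --> U] --> l) -> f m @[m --> 0^'+] --> l.
Proof.
move=> h N Nl; apply: contrapT => nN.
pose Bad := ~` (f @^-1` N).
have FF : ProperFilter (within Bad 0^'+).
  apply: Build_ProperFilter; rewrite /within /= => h0; apply: nN.
  by apply: filterS h0 => m hm; apply: contrapT => Nm; exact: (hm Nm).
have [U [UU sU]] := ultraFilterLemma FF.
have sU0 : 0^'+ `<=` U by move=> A A0; apply: sU; apply: filterS A0 => m Am _.
have UB : U Bad by apply: sU; rewrite /within /=; apply: filterS filterT => m _.
have UN : U (f @^-1` N) := h U UU sU0 N Nl.
have UF : ProperFilter U by exact: ultra_proper.
by have [m [h1 h2]] := filter_ex (filterI UB UN); exact: h1.
Qed.

Lemma family_compact_cvg (sol : R -> R -> R) w K : 0 < K ->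
  (forall m y z, 0 < m <= 1 -> `|sol m z - sol m y| <= K * `|z - y|) ->
  (forall x, sol m x @[m --> 0^'+] --> w x) ->
  {family compact, sol m @[m --> 0^'+] --> w}.
Proof.
move=> K0 KP lw; apply/fam_cvgP => A cA N; rewrite uniform_nbhs => -[E [entE EN]].
move: entE; rewrite -entourage_ballE => -[e /= e0 eE].
have [M MA] : exists M, forall x, A x -> `|x| <= M.
  have [M [_ MP]] := compact_bounded cA; exists (`|M| + 1) => x Ax.
  by apply: (MP (`|M| + 1)) => //; have := ler_norm M; lra.
have U01 : \forall m \near (0 : R)^'+, 0 < m <= 1.
  near=> m; apply/andP; split; near: m; first exact: nbhs_right_gt.
  exact: nbhs_right_le.
have e20 : 0 < e / 2 by rewrite divr_gt0.
have hu := @loc_unif _ _ sol w K (- M) M _ (at_right_proper_filter 0) K0 U01 KP lw e20.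
suff : \forall m \near (0 : R)^'+, N (sol m) by [].
apply: filterS hu => m hm; apply: EN => y Ay; apply: eE => /=.
rewrite /ball /=; have : `|w y - sol m y| <= e / 2 by apply: hm; rewrite -ler_norml; exact: MA.
lra.
Unshelve. all: by end_near. Qed.

End Convergence.

Theorem theorem1 (R : realType) (H : R -> R -> R) (V : R -> R)
    (H_cont : continuous (fun z : R * R => H z.1 z.2))
    (H_periodic : forall p : R, periodic (fun x => H x p) 1)
    (H_convex : forall x : R, convex_function setT (H x : R^o -> R^o))
    (H_coercive : coercive H)
    (V_cont : continuous V)
    (V_supp : compact_support V)
    (G := fun x p : R => H x p - V x)
    (H_U : crit G = crit H -> crit H = crit_free H -> condition_U H)
    (uG : R -> R -> R)
    (uG_sol : discounted_solutions G uG) :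
  exists u0G : R -> R,
    {family compact, uG lam @[lam --> 0^'+] --> u0G} /\
    visc_sol (stationary G (crit G)) u0G.
Proof.
have [gH pH] := good_periodic H_cont H_periodic H_convex H_coercive.
have gG : good (pert H V) := good_sub gH V_cont V_supp.
have [X X0 VX0] := compact_support_zero V_supp.
have VX x : X <= x -> V x = 0 by move=> h; apply: VX0; exact: le_trans h (ler_norm _).
have VXl x : x <= - X -> V x = 0.
  by move=> h; apply: VX0; rewrite -normrN; apply: le_trans (ler_norm _); rewrite lerNr.
pose c := crit G.
have hc e : 0 < e -> exists v B, sub (pert H V) (fun=> c + e) setT v /\ forall x, `|v x| <= B.
  exact: crit_adherent.
have hmin a v B : sub (pert H V) (fun=> a) setT v -> (forall x, `|v x| <= B) -> c <= a.
  exact: crit_le.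
have adm0 := crit_drift0 gH pH VX VXl hc.
have [wb [B [swb wbB]]] := crit_wb gH gG X0 adm0 VX VXl hc.
have B0 := le_trans (normr_ge0 _) (wbB 0).
have bdd m : 0 < m -> exists D, forall x, `|uG m x| <= D.
  by move=> m0; have [_ /bounded_fun_exP] := uG_sol m m0.
(* One constant serves for [wb], bounded by [B], and for the lower bound of the solutions, which is
   [- (2 * B)]. *)
have S : setup H V c X (2 * B) uG.
  split=> //.
  - by exists wb => // x; apply: le_trans (wbB x) _; rewrite ler_peMl // ler1n.
  - move=> m /andP[m0 _]; have [[sb _] _] := uG_sol m m0; exact: discounted_sub.
  - by move=> m /andP[m0 _]; have [[_ sp] _] := uG_sol m m0.
  - by move=> m /andP[m0 _]; exact: bdd.
  - move=> m x /andP[m0 _]; have [[_ sp] _] := uG_sol m m0.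
    exact: (solution_lower_bound gG m0 sp (bdd m m0) swb wbB).
have [K K0 KP] := setup_lip S.
have [L LP] := loc_bounded S X0 VXl hmin.
have R01 : \forall m \near (0 : R)^'+, 0 < m <= 1.
  near=> m; apply/andP; split; near: m; first exact: nbhs_right_gt.
  exact: nbhs_right_le.
have nL x : \forall m \near 0^'+, `|uG m x| <= L x.
  by apply: filterS R01 => m m01; exact: LP.
have lim_sub (U : set_system R) w : ProperFilter U -> 0^'+ `<=` U ->
    (forall x, uG m x @[m --> U] --> w x) -> sub (pert H V) (fun=> c) setT w.
  move=> UF sU lw; apply: (@sub_ultra _ _ U _ _ _ uG _ c) => //; first exact: cont_cst.
  move=> e e0; apply: sU; near=> m.
  have m0 : 0 < m by near: m; exact: nbhs_right_gt.
  have m1 : m <= 1 by near: m; exact: nbhs_right_le.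
  have m01 : 0 < m <= 1 by rewrite m0.
  (* Makes [- m * uG m] at most [e]; the 1 guards against [B = 0]. *)
  have me : m <= e / (2 * B + 1).
    by near: m; apply: nbhs_right_le; rewrite divr_gt0 // ltr_wpDl // mulr_ge0.
  apply: sub_le (st_sub S m01) _ _ => // x _; rewrite lerD2l -mulrN.
  have h1 : - uG m x <= 2 * B by rewrite lerNl; exact: (st_lb S).
  have h2 : m * - uG m x <= m * (2 * B) by rewrite ler_pM2l.
  rewrite ler_pdivlMr ?ltr_wpDl // ?mulr_ge0 // in me.
  by clear - h2 me m0; lra.
have [U [UU sU [w lw]]] := ultra_limit nL.
have UF : ProperFilter U by exact: ultra_proper.
have sw := lim_sub U w UF sU lw.
have lw0 x : uG m x @[m --> 0^'+] --> w x.
  apply: cvg_of_ultra => U' UU' sU'.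
  have UF' : ProperFilter U' by exact: ultra_proper.
  have /choice[w' lw'] : forall x, exists l : R, uG m x @[m --> U'] --> l.
    by move=> y; apply: (@ultra_cvg _ _ U' (uG ^~ y) (L y)) => //; apply: sU'; exact: nL.
  have sw' := lim_sub U' w' UF' sU' lw'.
  have -> : w x = w' x; last exact: lw'.
  apply/eqP; rewrite eq_le; apply/andP; split.
    exact: (limits_le UF UF' sU sU' S VXl lw lw' sw).
  exact: (limits_le UF' UF sU' sU S VXl lw' lw sw').
exists w; split; first exact: family_compact_cvg KP lw0.
split; first exact/visc_subP.
apply: (supersol_limit gG UF K0 sU _ KP lw (proj1 sw)) => m m01.
exact: (st_sup S m01).
Unshelve. all: by end_near. Qed.
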